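(* Let $\alpha\in\mathbb R$ and suppose the cost function $c$ has constant cross curvature $-4\alpha$ on $TM\wedge TM'$, i.e. $$\overline{\sec}_u(X,Y)=-4\alpha\left(h(X,X)h(Y,Y)-h(X,Y)^2\right)$$ for all $X=v\oplus 0$, $Y=0\oplus\bar v\in T_{(p,q')}(M\times M')$ and all $(p,q')\in M\times M'$. Then any graph $G$ of optimal transport has constant information-geometric sectional curvature $-\alpha$, i.e. for all $X,Y$ tangent to $G$ at the same point, $$\sec_u(X,Y)=\sec_u^*(X,Y)=-\alpha\left(g(X,X)g(Y,Y)-g(X,Y)^2\right).$$ Consequently, $c$ has constant sectional curvature $-\alpha$ on $G$, i.e. for all $X,Y$ tangent to $G$ at the same point, $$\overline{\sec}_u(X,Y)=-\alpha\left(h(X,X)h(Y,Y)-h(X,Y)^2\right).$$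
   Context: Setting. $M,M'$ are $n$-dimensional smooth manifolds ($n\ge 2$), and $c:M\times M'\to\mathbb R$ is a smooth cost function. In local coordinates $\xi=(\xi^1,\dots,\xi^n)$ on $M$ and $\eta'=(\eta'^{\bar 1},\dots,\eta'^{\bar n})$ on $M'$ write $c_{i:\bar j}=\frac{\partial^2 c}{\partial\xi^i\partial\eta'^{\bar j}}$. The cost is assumed non-degenerate: the matrix $(c_{i:\bar j})$ is invertible at every point. Einstein summation is used. Graph of optimal transport. $\varphi:M\to\mathbb R$ is smooth and $c$-concave, i.e. there is $\psi:M'\to\mathbb R\cup\{-\infty\}$ with $\varphi(p)=\inf_{q'\in M'}(c(p,q')-\psi(q'))$ for all $p\in M$. For each $p\in M$ there is a unique $q'=:D^c\varphi(p)\in M'$ with $\varphi(p)+\psi(q')=c(p,q')$, and $f=D^c\varphi$ is a smooth diffeomorphism from $M$ onto its range $f(M)\subset M'$. $\psi$ is the $c$-transform of $\varphi$: $\psi(q)=\inf_{p\in M}(c(p,q)-\varphi(p))$, so $\psi(q)=c(f^{-1}(q),q)-\varphi(f^{-1}(q))$ for $q\in f(M)$. A graph of optimal transport is $G=\{(p,f(p)):p\in M\}$ for such an $f$; it is an $n$-dimensional embedded submanifold of $M\times M'$. $c$-divergence and dualistic structure. For $x=(p,q),\,x'=(p',q')\in G$, $\mathbf D[x:x']=c(p,q')-\varphi(p)-\psi(q')$. Using coordinates $\xi$ on $G$ via $(p,f(p))\mapsto p$ and writing $\mathbf D=\mathbf D[\xi:\xi']$, define $g_{ij}(\xi)=-\frac{\partial}{\partial\xi^i}\frac{\partial}{\partial\xi'^j}\mathbf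 D\big|_{\xi'=\xi}$ (a Riemannian metric on $G$), $\Gamma_{ijk}(\xi)=-\frac{\partial^2}{\partial\xi^i\partial\xi^j}\frac{\partial}{\partial\xi'^k}\mathbf D\big|_{\xi'=\xi}$, $\Gamma^*_{ijk}(\xi)=-\frac{\partial^2}{\partial\xi'^i\partial\xi'^j}\frac{\partial}{\partial\xi^k}\mathbf D\big|_{\xi'=\xi}$. The torsion-free connections $\nabla,\nabla^*$ on $G$ have Christoffel symbols $\Gamma_{ij}{}^k=\Gamma_{ijm}g^{mk}$ and $\Gamma^*_{ij}{}^k=\Gamma^*_{ijm}g^{mk}$, with $\nabla_{\partial_i}\partial_j=\Gamma_{ij}{}^k\partial_k$ (similarly for $\nabla^*$). Pseudo-Riemannian metric $h$ on $M\times M'$. For $v=a^i\frac{\partial}{\partial\xi^i}+b^{\bar i}\frac{\partial}{\partial\eta'^{\bar i}}$ at $(\xi,\eta')$, $h(v,v)=-c_{i:\bar j}(\xi,\eta')a^ib^{\bar j}$, extended by polarization. $\bar\nabla$ is the Levi-Civita connection of $h$. Direct sums refer to $T_{(p,q')}(M\times M')=T_pM\oplus T_{q'}M'$. Curvature. The curvature tensor of a connection is $R(X,Y)Z=\nabla_X\nabla_YZ-\nabla_Y\nabla_XZ-\nabla_{[X,Y]}Z$; write $R,R^*,\bar R$ for those of $\nabla,\nabla^*,\bar\nabla$. Then $\overline{\sec}_u(X,Y)=h(\bar R(X,Y)Y,X)$, $\sec_u(X,Y)=g(R(X,Y)Y,X)$, $\sec_u^*(X,Y)=g(R^*(X,Y)Y,X)$.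 *)

(* Defs.v *)
From mathcomp Require Import all_boot all_order all_algebra.
From mathcomp Require Import all_classical all_reals all_analysis.
From mathcomp Require Import ring.

Set Implicit Arguments.
Unset Strict Implicit.
Unset Printing Implicit Defensive.
Import Order.TTheory GRing.Theory Num.Theory.
Import numFieldNormedType.Exports.

Local Open Scope classical_set_scope.
Local Open Scope ring_scope.

Section Calculus.
Context {R : realType} {m : nat}.
Implicit Types (f : 'rV[R]_m -> R) (U : set 'rV[R]_m).

Definition basis_vec (i : 'I_m) : 'rV[R]_m := delta_mx 0 i.

Definition pd (i : 'I_m) f : 'rV[R]_m -> R := fun x => 'D_(basis_vec i) f x.

(* C^infty on U: all iterated partial derivatives are (Frechet) differentiable
   at every point of U. Only meant for open U. *)
Definition smooth_on U f : Prop :=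
  forall (s : seq 'I_m) (x : 'rV[R]_m), U x ->
    differentiable (foldr pd f s) x.

End Calculus.

Section LocalGeometry.
Context {R : realType} {m : nat}.

Definition vfield := 'rV[R]_m -> 'rV[R]_m.

(* [g x] is the Gram matrix of the metric in the coordinate frame at x. *)
Definition metric := 'rV[R]_m -> 'M[R]_m.

(* [G x i j k] is either Gamma_{ijk} or Gamma_{ij}^k at x. *)
Definition symbols := 'rV[R]_m -> 'I_m -> 'I_m -> 'I_m -> R.

Implicit Types (X Y Z : vfield) (g : metric) (G : symbols) (x u v : 'rV[R]_m).

Definition inner g x u v : R := (u *m g x *m v^T) 0 0.

Definition gram g x u v : R :=
  inner g x u u * inner g x v v - inner g x u v ^+ 2.

Definition raise_index g G : symbols := fun x i j k =>
  \sum_l G x i j l * invmx (g x) l k.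

Definition covariant G X Y : vfield := fun x =>
  'D_(X x) Y x + \row_k \sum_i \sum_j G x i j k * X x 0 i * Y x 0 j.

Definition lie_bracket X Y : vfield := fun x => 'D_(X x) Y x - 'D_(Y x) X x.

Definition curvature G X Y Z : vfield := fun x =>
  covariant G X (covariant G Y Z) x - covariant G Y (covariant G X Z) x
  - covariant G (lie_bracket X Y) Z x.

(* The curvature is tensorial, so it is evaluated on tangent vectors at x by
   extending them with constant components in the chart. *)
Definition sec g G x u v : R :=
  inner g x (curvature G (cst u) (cst v) (cst v) x) u.

Definition levi_civita_first g : symbols := fun x i j k =>
  2^-1 * (pd i (fun y => g y j k) x + pd j (fun y => g y i k) x
          - pd k (fun y => g y i j) x).

Definition levi_civita g : symbols := raise_index g (levi_civita_first g).

Lemma levi_civita_lower g x i j l : g x \in unitmx ->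
  \sum_k levi_civita g x i j k * g x k l = levi_civita_first g x i j l.
Proof.
move=> gu; pose r := \row_k levi_civita_first g x i j k.
have -> : \sum_k levi_civita g x i j k * g x k l =
          (r *m invmx (g x) *m g x) 0 l.
  rewrite [RHS]mxE; apply: eq_bigr => k _; congr (_ * _).
  by rewrite !mxE; apply: eq_bigr => k' _; rewrite !mxE.
by rewrite mulmxKV // mxE.
Qed.

(* [levi_civita g] is the torsion-free, g-compatible connection. *)
Lemma levi_civita_torsion_free g x i j k : (forall y, (g y)^T = g y) ->
  levi_civita g x i j k = levi_civita g x j i k.
Proof.
move=> gT; apply: eq_bigr => l _; congr (_ * _).
rewrite /levi_civita_first; congr (_ * (_ - _)); first by rewrite addrC.
by congr (pd _ _ _); apply/funext => y; rewrite -[in LHS]gT mxE.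
Qed.

Lemma levi_civita_compatible g x i j k :
  (forall y, (g y)^T = g y) -> g x \in unitmx ->
  pd k (fun y => g y i j) x =
  \sum_l levi_civita g x k i l * g x l j +
  \sum_l levi_civita g x k j l * g x i l.
Proof.
move=> gT gu; have gE y a b : g y a b = g y b a by rewrite -[in LHS]gT mxE.
have pdE l a b : pd l (fun y => g y a b) x = pd l (fun y => g y b a) x.
  by congr (pd _ _ _); apply/funext => y.
under [X in _ + X]eq_bigr do rewrite gE.
rewrite !levi_civita_lower// /levi_civita_first -mulrDr (pdE k j i).
by field.
Qed.

End LocalGeometry.
Arguments vfield : clear implicits.
Arguments metric : clear implicits.
Arguments symbols : clear implicits.

Record chart (R : realType) (n : nat) (T : topologicalType) := Chart {
  cdom : set T;
  ccoord : T -> 'rV[R]_n;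
  cinv : 'rV[R]_n -> T;
  cdom_open : open cdom;
  cimg_open : open (ccoord @` cdom);
  ccoordK : {in cdom, cancel ccoord cinv};
  ccoord_continuous : forall p, cdom p -> {for p, continuous ccoord};
  cinv_continuous :
    forall x, (ccoord @` cdom) x -> {for x, continuous cinv}
}.

Definition cimg (R : realType) n (T : topologicalType) (a : chart R n T) :=
  ccoord a @` cdom a.

Record smoothManifold (R : realType) (n : nat) := SmoothManifold {
  mcarrier :> topologicalType;
  atlas : set (chart R n mcarrier);
  mhausdorff : hausdorff_space mcarrier;
  msecond_countable : @second_countable mcarrier;
  atlas_cover : forall p : mcarrier, exists2 a, atlas a & cdom a p;
  atlas_compat : forall a b, atlas a -> atlas b -> forall k : 'I_n,
    smooth_on (ccoord a @` (cdom a `&` cdom b))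
      (fun x => ccoord b (cinv a x) 0 k)
}.

Section SmoothMaps.
Context {R : realType} {n n' : nat}.

Definition smooth_fun (M : smoothManifold R n) (phi : M -> R) : Prop :=
  forall a, atlas a -> smooth_on (cimg a) (phi \o cinv a).

(* [A] is meant to be open. *)
Definition smooth_map (M : smoothManifold R n) (N : smoothManifold R n')
    (A : set M) (F : M -> N) : Prop :=
  (forall p, A p -> {for p, continuous F}) /\
  forall (a : chart R n M) (b : chart R n' N), atlas a -> atlas b ->
    forall k : 'I_n',
      smooth_on (ccoord a @` (A `&` cdom a `&` F @^-1` cdom b))
        (fun x => ccoord b (F (cinv a x)) 0 k).

End SmoothMaps.

(* The range of a diffeomorphism between manifolds of equal dimension is an
   open submanifold of the target. *)
Definition diffeo_onto_range (R : realType) n (M N : smoothManifold R n)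
    (f : M -> N) : Prop :=
  [/\ smooth_map setT f, open (range f) &
      exists2 finv : N -> M, cancel f finv & smooth_map (range f) finv].

Section Cost.
Context {R : realType} {n : nat} {M M' : smoothManifold R n}.
Implicit Types (c : M * M' -> R) (a : chart R n M) (b : chart R n M').

(* The coordinates (xi, eta') on M x M' are [row_mx xi eta']. *)
Definition cost_rep c a b : 'rV[R]_(n + n) -> R := fun z =>
  c (cinv a (lsubmx z), cinv b (rsubmx z)).

Definition smooth_cost c : Prop :=
  forall a b, atlas a -> atlas b ->
    smooth_on [set z | cimg a (lsubmx z) /\ cimg b (rsubmx z)]
      (cost_rep c a b).

(* The matrix (c_{i:\bar j}) at z. *)
Definition mixed_hessian c a b (z : 'rV[R]_(n + n)) : 'M[R]_n :=
  \matrix_(i, j) pd (lshift n i) (pd (rshift n j) (cost_rep c a b)) z.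

Definition nondegenerate_cost c : Prop :=
  forall a b, atlas a -> atlas b -> forall p q, cdom a p -> cdom b q ->
    mixed_hessian c a b (row_mx (ccoord a p) (ccoord b q)) \in unitmx.

Definition h_quad c a b (z v : 'rV[R]_(n + n)) : R :=
  - \sum_i \sum_j mixed_hessian c a b z i j * lsubmx v 0 i * rsubmx v 0 j.

Definition h_metric c a b : metric R (n + n) := fun z =>
  \matrix_(k, l) (2^-1 *
    (h_quad c a b z (basis_vec k + basis_vec l)
     - h_quad c a b z (basis_vec k) - h_quad c a b z (basis_vec l))).

Definition sec_bar c a b (z u v : 'rV[R]_(n + n)) : R :=
  sec (h_metric c a b) (levi_civita (h_metric c a b)) z u v.

Definition constant_cross_curvature c (kappa : R) : Prop :=
  forall a b, atlas a -> atlas b -> forall p q, cdom a p -> cdom b q ->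
  forall v v' : 'rV[R]_n,
    let z := row_mx (ccoord a p) (ccoord b q) in
    let X := row_mx v 0 in
    let Y := row_mx 0 v' in
    sec_bar c a b z X Y = kappa * gram (h_metric c a b) z X Y.

Definition c_transform c (phi : M -> R) (q : M') : \bar R :=
  ereal_inf [set (c (p, q) - phi p)%:E | p in [set: M]].

Definition c_concave c (phi : M -> R) : Prop :=
  exists2 psi : M' -> \bar R, (forall q, psi q != +oo%E) &
    forall p, (phi p)%:E =
      ereal_inf [set ((c (p, q))%:E - psi q)%E | q in [set: M']].

Definition is_c_gradient c (phi : M -> R) (f : M -> M') : Prop :=
  forall p,
    unique (fun q => ((phi p)%:E + c_transform c phi q)%E = (c (p, q))%:E)
      (f p).

Definition optimal_transport c (phi : M -> R) (f : M -> M') : Prop :=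
  [/\ smooth_fun phi, c_concave c phi, is_c_gradient c phi f &
      diffeo_onto_range f].

(* On the graph of f the c-transform is finite. *)
Definition c_divergence c (phi : M -> R) (x x' : M * M') : R :=
  c (x.1, x'.2) - phi x.1 - fine (c_transform c phi x'.2).

Definition graph_param (f : M -> M') a (x : 'rV[R]_n) : M * M' :=
  (cinv a x, f (cinv a x)).

Definition div_rep c phi f a (x x' : 'rV[R]_n) : R :=
  c_divergence c phi (graph_param f a x) (graph_param f a x').

(* [graph_param] read in the coordinates of M x M'. *)
Definition graph_rep (f : M -> M') a b (x : 'rV[R]_n) : 'rV[R]_(n + n) :=
  row_mx (ccoord a (graph_param f a x).1) (ccoord b (graph_param f a x).2).

Definition graph_tangent (f : M -> M') a b (x : 'rV[R]_n)
    (X : 'rV[R]_(n + n)) : Prop :=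
  exists v : 'rV[R]_n, X = 'D_v (graph_rep f a b) x.

End Cost.

Section Dualistic.
Context {R : realType} {n : nat}.
Implicit Type D : 'rV[R]_n -> 'rV[R]_n -> R.

Definition div_metric D : metric R n := fun x =>
  \matrix_(i, j) - pd i (fun y => pd j (fun y' => D y y') x) x.

Definition div_primal_first D : symbols R n := fun x i j k =>
  - pd i (pd j (fun y => pd k (fun y' => D y y') x)) x.

Definition div_dual_first D : symbols R n := fun x i j k =>
  - pd i (pd j (fun y' => pd k (fun y => D y y') x)) x.

Definition div_primal D : symbols R n :=
  raise_index (div_metric D) (div_primal_first D).

Definition div_dual D : symbols R n :=
  raise_index (div_metric D) (div_dual_first D).

End Dualistic.

(* Main.v *)
Require Import Defs.
From HB Require Import structures.
From mathcomp Require Import all_boot all_order all_algebra.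
From mathcomp Require Import all_classical all_reals all_analysis.
From mathcomp Require Import ring lra.

Set Implicit Arguments.
Unset Strict Implicit.
Unset Printing Implicit Defensive.
Import Order.TTheory GRing.Theory Num.Theory.
Import numFieldNormedType.Exports.

Local Open Scope classical_set_scope.
Local Open Scope ring_scope.

(* Write C for the matrix (c_{i:j}) and let A_u be the matrix of the connection
   along a constant vector field u. The Levi-Civita connection of h is block
   diagonal, A_(a,a') = diag(P_a, Q_a') with P_a = (D_a C) C^-1 and
   Q_a' = (D_a' C)^T C^-T, so that its curvature only involves
     S(v, v') = D_v D_v' C - (D_v C) C^-1 (D_v' C).
   The quantity w S(v, v') w'^T is symmetric in (v, w) and in (v', w'), hence the
   hypothesis v S(v, v') v'^T = - 2 alpha (v C v'^T)^2 polarizes to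
     w S(v, v') w'^T = - alpha (v C v'^T w C w'^T + v C w'^T w C v'^T).
   On the graph of f, with Jacobian matrix J, the metric is g = - C J^T; it is
   symmetric because c_i(y, f(y)) = d_i phi(y), the divergence being minimal on
   the diagonal. The primal connection is the restriction of P_u, hence its
   curvature is the first block of the ambient one, evaluated on the vectors
   (u, uJ). The dual curvature is obtained from the primal one by duality with
   respect to g. *)

(** * Differential calculus of matrix-valued maps *)

(** The dual connection is the obstacle. Its symbols differentiate the second argument of the
    divergence twice; that argument passes through f, so they contain derivatives of J, and a direct
    computation of the dual curvature would meet third derivatives of f. In the primal symbols the
    two repeated derivatives fall on the first argument while f stays frozen, so that J is merely a
    constant factor. This is why only the primal curvature is computed and then transferred.

    The factor 4 is an effect of polarization. The metric h pairs (v, 0) with (0, v') to - v C v'^T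
    / 2, so the Gram determinant of a cross plane is - (v C v'^T)^2 / 4. On the vectors (u, uJ) and
    (v, vJ), in contrast, the two halves of h agree by the symmetry of g and add up to g(u, v), so
    the Gram determinant is that of g. *)

Section Differentiable.
Context {R : realType} {V : normedModType R}.

(** The difference g - f vanishes near x, so 0 serves as its differential there, and g = f + (g -
    f). *)
Lemma near_eq_differentiable {W : normedModType R} (f g : V -> W) (x : V) :
  (\near x, f x = g x) -> differentiable f x -> differentiable g x.
Proof.
move=> fg df; pose e := g - f.
have ge : g = f + e by apply/funext => y; rewrite /e !fctE addrC subrK.
have e0 : \near x, e x = 0 by near=> y; rewrite /e !fctE (near fg) ?subrr.
have [c0 de] : continuous (0 : V -> W) /\
    e \o shift x = cst (e x) + (0 : V -> W) +o_ 0 id.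
  split; first by move=> y; exact: cvg_cst.
  apply/eqaddoP => _ /posnumP[eps]; near=> h.
  have eh : e (h + x) = 0.
    near: h; have := e0; rewrite [X in X -> _](near_shift 0 x) /= subr0.
    exact.
  rewrite !fctE /= eh (nbhs_singleton e0) addr0 subrr normr0.
  by rewrite mulr_ge0.
rewrite ge; apply: differentiableD => //.
have d0 : 'd e x = 0 :> (V -> W) by apply/diff_unique.
by apply/diff_locallyP; rewrite d0.
Unshelve. all: by end_near. Qed.

End Differentiable.

(* Locked because conversion otherwise unfolds the limits behind 'D_v. *)
HB.lock Definition dmx (R : realType) (V : normedModType R) p q (v : V)
    (A : V -> 'M[R]_(p, q)) (x : V) : 'M[R]_(p, q) :=
  \matrix_(i, j) 'D_v (fun y => A y i j) x.
Canonical dmx_unlockable := Unlockable dmx.unlock.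

Section MatrixDerivative.
Context {R : realType} {V : normedModType R}.
Implicit Types (x v : V) (f : V -> R).

Lemma differentiable_sumf (I : Type) (r : seq I) (P : pred I) (h : I -> V -> R) x :
  (forall i, differentiable (h i) x) ->
  differentiable (fun y => \sum_(i <- r | P i) h i y) x.
Proof.
move=> dh; elim: r => [|i r IH].
  have -> : (fun y => \sum_(i <- [::] | P i) h i y) = cst 0.
    by apply/funext => y; rewrite big_nil.
  exact: differentiable_cst.
case Pi : (P i); last first.
  suff -> : (fun y => \sum_(j <- i :: r | P j) h j y) =
      (fun y => \sum_(j <- r | P j) h j y) by [].
  by apply/funext => y; rewrite big_cons Pi.
have -> : (fun y => \sum_(j <- i :: r | P j) h j y) =
    h i + (fun y => \sum_(j <- r | P j) h j y).
  by apply/funext => y; rewrite big_cons Pi.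
exact: differentiableD.
Qed.

Lemma differentiable_prodf (I : Type) (r : seq I) (h : I -> V -> R) x :
  (forall i, differentiable (h i) x) ->
  differentiable (fun y => \prod_(i <- r) h i y) x.
Proof.
move=> dh; elim: r => [|i r IH].
  have -> : (fun y => \prod_(i <- [::]) h i y) = cst 1.
    by apply/funext => y; rewrite big_nil.
  exact: differentiable_cst.
have -> : (fun y => \prod_(j <- i :: r) h j y) =
    h i * (fun y => \prod_(j <- r) h j y).
  by apply/funext => y; rewrite big_cons.
exact: differentiableM.
Qed.

Lemma derive_sumf n (h : 'I_n -> V -> R) x v :
  (forall i, differentiable (h i) x) ->
  'D_v (fun y => \sum_i h i y) x = \sum_i 'D_v (h i) x.
Proof.
move=> dh; rewrite -derive_sum; last by move=> i; apply: diff_derivable.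
by congr ('D_v _ x); apply/funext => y; rewrite fct_sumE.
Qed.

Lemma differentiable_mull (a : R) f x :
  differentiable f x -> differentiable (fun y => a * f y) x.
Proof. by move=> df; exact: (differentiableM (differentiable_cst a x) df). Qed.

Definition differentiable_mx p q (A : V -> 'M[R]_(p, q)) x :=
  forall i j, differentiable (fun y => A y i j) x.

Lemma dmxE p q v (A : V -> 'M[R]_(p, q)) x i j :
  dmx v A x i j = 'D_v (fun y => A y i j) x.
Proof. by rewrite unlock mxE. Qed.

Lemma near_eq_dmx p q v (A B : V -> 'M[R]_(p, q)) x :
  (\near x, A x = B x) -> dmx v A x = dmx v B x.
Proof.
move=> AB; apply/matrixP => i j; rewrite !(dmxE, mxE); apply: near_eq_derive.
by near=> y; rewrite (near AB y).
Unshelve. all: by end_near. Qed.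

Lemma near_eq_differentiable_mx p q (A B : V -> 'M[R]_(p, q)) x :
  (\near x, A x = B x) -> differentiable_mx A x -> differentiable_mx B x.
Proof.
move=> AB dA i j; apply: near_eq_differentiable (dA i j).
by near=> y; rewrite (near AB y).
Unshelve. all: by end_near. Qed.

Lemma differentiable_mx_cst p q (A : 'M[R]_(p, q)) x :
  differentiable_mx (fun=> A) x.
Proof. by move=> i j; apply: differentiable_cst. Qed.

Lemma dmx_cst p q v (A : 'M[R]_(p, q)) x : dmx v (fun=> A) x = 0.
Proof. by apply/matrixP => i j; rewrite !(dmxE, mxE); exact: derive_cst. Qed.

Lemma differentiable_mxD p q (A B : V -> 'M[R]_(p, q)) x :
  differentiable_mx A x -> differentiable_mx B x ->
  differentiable_mx (fun y => A y + B y) x.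
Proof.
move=> dA dB i j; under eq_fun do rewrite mxE.
exact: differentiableD (dA i j) (dB i j).
Qed.

Lemma dmxD p q v (A B : V -> 'M[R]_(p, q)) x :
  differentiable_mx A x -> differentiable_mx B x ->
  dmx v (fun y => A y + B y) x = dmx v A x + dmx v B x.
Proof.
move=> dA dB; apply/matrixP => i j; rewrite !(dmxE, mxE); under eq_fun do rewrite mxE.
exact: (deriveD (diff_derivable (dA i j)) (diff_derivable (dB i j))).
Qed.

Lemma differentiable_mxN p q (A : V -> 'M[R]_(p, q)) x :
  differentiable_mx A x -> differentiable_mx (fun y => - A y) x.
Proof.
by move=> dA i j; under eq_fun do rewrite mxE; exact: differentiableN (dA i j).
Qed.

Lemma dmxN p q v (A : V -> 'M[R]_(p, q)) x :
  differentiable_mx A x -> dmx v (fun y => - A y) x = - dmx v A x.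
Proof.
move=> dA; apply/matrixP => i j; rewrite !(dmxE, mxE); under eq_fun do rewrite mxE.
exact: (deriveN (diff_derivable (dA i j))).
Qed.

Lemma differentiable_trmx p q (A : V -> 'M[R]_(p, q)) x :
  differentiable_mx A x -> differentiable_mx (fun y => (A y)^T) x.
Proof. by move=> dA i j; under eq_fun do rewrite mxE; exact: dA. Qed.

Lemma dmx_tr p q v (A : V -> 'M[R]_(p, q)) x :
  dmx v (fun y => (A y)^T) x = (dmx v A x)^T.
Proof.
by apply/matrixP => i j; rewrite !(dmxE, mxE); under eq_fun do rewrite mxE.
Qed.

Lemma differentiable_mulmx p q r (A : V -> 'M[R]_(p, q)) (B : V -> 'M[R]_(q, r))
    x : differentiable_mx A x -> differentiable_mx B x ->
  differentiable_mx (fun y => A y *m B y) x.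
Proof.
move=> dA dB i j; under eq_fun do rewrite mxE.
by apply: differentiable_sumf => k; exact: differentiableM (dA i k) (dB k j).
Qed.

Lemma dmxM p q r v (A : V -> 'M[R]_(p, q)) (B : V -> 'M[R]_(q, r)) x :
  differentiable_mx A x -> differentiable_mx B x ->
  dmx v (fun y => A y *m B y) x = dmx v A x *m B x + A x *m dmx v B x.
Proof.
move=> dA dB; apply/matrixP => i j; rewrite !(dmxE, mxE); under eq_fun do rewrite mxE.
rewrite derive_sumf; last first.
  by move=> k; exact: differentiableM (dA i k) (dB k j).
rewrite -big_split; apply: eq_bigr => k _ /=; rewrite !(dmxE, mxE).
rewrite (deriveM (diff_derivable (dA i k)) (diff_derivable (dB k j))).
rewrite addrC; congr (_ + _); exact: mulrC.
Qed.

Lemma differentiable_det n (A : V -> 'M[R]_n) x :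
  differentiable_mx A x -> differentiable (fun y => \det (A y)) x.
Proof.
move=> dA; rewrite /determinant; apply: differentiable_sumf => s.
apply: differentiable_mull.
by apply: differentiable_prodf => i; exact: dA.
Qed.

Lemma near_unitmx n (A : V -> 'M[R]_n) x : differentiable_mx A x ->
  A x \in unitmx -> \near x, A x \in unitmx.
Proof.
move=> /differentiable_det/differentiable_continuous/= cA; rewrite unitmxE unitfE.
move=> A0; near=> y; rewrite unitmxE unitfE; near: y.
exact: cvgr_neq0 cA A0.
Unshelve. all: by end_near. Qed.

Lemma differentiable_invmx n (A : V -> 'M[R]_n) x : differentiable_mx A x ->
  A x \in unitmx -> differentiable_mx (fun y => invmx (A y)) x.
Proof.
move=> dA uA.
(* By Cramer's rule, [invmx] is the adjugate divided by the determinant on units; units form a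
   neighbourhood of A x, which is all that differentiability at x sees. *)
apply: (@near_eq_differentiable_mx _ _
  (fun y => \matrix_(i, j) ((\det (A y))^-1 * \adj (A y) i j))).
  near=> y; have uAy : A y \in unitmx by near: y; exact: near_unitmx.
  by rewrite /invmx uAy; apply/matrixP => i j; rewrite !mxE.
move=> i j; under eq_fun do rewrite mxE.
apply: (@differentiableM _ _ (fun y => (\det (A y))^-1)).
  apply: differentiableV; first exact: differentiable_det.
  by rewrite -unitfE -unitmxE.
under eq_fun do rewrite mxE /cofactor.
apply: differentiable_mull.
by apply: differentiable_det => k l; under eq_fun do rewrite !mxE; exact: dA.
Unshelve. all: by end_near. Qed.

(** Product rule applied to A A^-1 = 1, which holds near x. *)
Lemma dmx_invmx n v (A : V -> 'M[R]_n) x : differentiable_mx A x ->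
  A x \in unitmx ->
  dmx v (fun y => invmx (A y)) x = - (invmx (A x) *m dmx v A x *m invmx (A x)).
Proof.
move=> dA uA; have dI := differentiable_invmx dA uA.
have : dmx v (fun y => A y *m invmx (A y)) x = 0.
  rewrite -(dmx_cst v (1%:M : 'M[R]_n) x); apply: near_eq_dmx.
  by near=> y; rewrite mulmxV //; near: y; exact: near_unitmx.
rewrite dmxM // => /eqP; rewrite addrC addr_eq0 => /eqP /(congr1 (mulmx (invmx (A x)))).
by rewrite mulKmx // mulmxN mulmxA.
Unshelve. all: by end_near. Qed.

End MatrixDerivative.

(** * Linearity in the direction and the chain rule *)

Section Directions.
Context {R : realType} {V W : normedModType R}.
Implicit Types (x u v : V).

Lemma derive_addv (f : V -> W) x u v :
  differentiable f x -> 'D_(u + v) f x = 'D_u f x + 'D_v f x.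
Proof. by move=> df; rewrite !deriveE // linearD. Qed.

Lemma derive_compose (Z : normedModType R) (G : V -> W) (f : W -> Z) x v :
  differentiable G x -> differentiable f (G x) ->
  'D_v (fun y => f (G y)) x = 'D_('D_v G x) f (G x).
Proof.
move=> dG df; rewrite !deriveE //; last exact: differentiable_comp.
by rewrite (diff_comp dG df).
Qed.

Lemma dmx_addv p q (A : V -> 'M[R]_(p, q)) x u v :
  differentiable_mx A x -> dmx (u + v) A x = dmx u A x + dmx v A x.
Proof.
move=> dA; apply/matrixP => i j; rewrite mxE !dmxE deriveE; last exact: dA.
by rewrite linearD -!deriveE //; exact: dA.
Qed.

Lemma derive_dmx p q (A : V -> 'M[R]_(p, q)) x v :
  differentiable_mx A x -> 'D_v A x = dmx v A x.
Proof.
move=> dA; rewrite derive_mx; last first.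
  apply/derivable_mxP => i j.
  exact: diff_derivable (dA i j).
by apply/matrixP => i j; rewrite dmxE mxE.
Qed.

(** Expansion in the standard basis turns entrywise differentiability into the Fréchet
    differentiability that the chain rule asks for. *)
Lemma differentiable_mx_differentiable n (G : V -> 'rV[R]_n) x :
  differentiable_mx G x -> differentiable G x.
Proof.
move=> dG.
have -> : G = \sum_(j < n) (fun y => G y 0 j *: (delta_mx 0 j : 'rV[R]_n)).
  apply/funext => y; rewrite fct_sumE [LHS]row_sum_delta.
  by [].
apply: differentiable_sum => j; apply: differentiableZl; exact: dG.
Qed.

End Directions.

Section Composition.
Context {R : realType} {V : normedModType R} {n : nat}.
Implicit Types (x v : V) (G : V -> 'rV[R]_n).

Lemma derive_comp_row G (f : 'rV[R]_n -> R) x v :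
  differentiable_mx G x -> differentiable f (G x) ->
  'D_v (fun y => f (G y)) x = 'D_(dmx v G x) f (G x).
Proof.
move=> dG df; rewrite -derive_dmx // derive_compose //.
exact: differentiable_mx_differentiable.
Qed.

Lemma differentiable_mx_comp p q G (A : 'rV[R]_n -> 'M[R]_(p, q)) x :
  differentiable_mx G x -> differentiable_mx A (G x) ->
  differentiable_mx (fun y => A (G y)) x.
Proof.
move=> dG dA i j.
exact: (differentiable_comp (differentiable_mx_differentiable dG) (dA i j)).
Qed.

Lemma dmx_comp p q G (A : 'rV[R]_n -> 'M[R]_(p, q)) x v :
  differentiable_mx G x -> differentiable_mx A (G x) ->
  dmx v (fun y => A (G y)) x = dmx (dmx v G x) A (G x).
Proof.
move=> dG dA; apply/matrixP => i j; rewrite !dmxE.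
exact: (derive_comp_row v dG (dA i j)).
Qed.

End Composition.

Section Partials.
Context {R : realType} {m : nat}.
Implicit Types (f : 'rV[R]_m -> R) (U : set 'rV[R]_m).

Lemma derive_pd f x v : differentiable f x ->
  'D_v f x = \sum_i v 0 i * pd i f x.
Proof.
move=> df; rewrite deriveE // {1}(row_sum_delta v) linear_sum.
by apply: eq_bigr => i _; rewrite linearZ /pd deriveE.
Qed.

End Partials.

(** * Symmetry of second derivatives *)

Section MixedPartials.
Context {R : realType} {V : normedModType R}.
Implicit Types (f : V -> R) (x u v w : V).

Lemma is_derive_line f w u (s : R) : differentiable f (s *: u + w) ->
  is_derive s 1 (fun t : R => f (t *: u + w)) ('D_u f (s *: u + w)).
Proof.
move=> df.
have dl : is_diff s (fun t : R => t *: u + w) (fun t : R => t *: u).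
  apply: is_diff_eq (is_diffD (is_diff_scalel s u) (is_diff_cst w s)) _.
  by apply/funext => t; rewrite !fctE addr0.
have dl' : differentiable (fun t : R => t *: u + w) s by exact: ex_diff.
apply: DeriveDef.
  apply/derivable1_diffP.
  exact: (differentiable_comp dl' (df : differentiable f ((fun t : R => t *: u + w) s))).
rewrite (derive_compose (G := fun t : R => t *: u + w)) //.
suff -> : 'D_1 (fun t : R => t *: u + w) s = u by [].
by rewrite deriveE // (@diff_val _ _ _ _ _ _ _ dl) scale1r.
Qed.

(** The mean value theorem for s |-> f (s u + t v + x) - f (s u + x) on [0, t] turns the second
    difference into t times an increment of [fu] over t v; the first-order expansion of [fu] at x
    then evaluates this increment up to o(t). *)
Lemma second_difference f fu x u v (e : R) : 0 < e ->
  (\near x, differentiable f x) -> (\near x, 'D_u f x = fu x) ->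
  differentiable fu x ->
  \forall t \near 0^'+,
    `|f (x + t *: u + t *: v) - f (x + t *: u) - f (x + t *: v) + f x
      - t ^+ 2 * 'D_v fu x| <= e * t ^+ 2.
Proof.
move=> e0 df fuE dfu.
(* For 0 <= s <= t, both s u + t v and s u have norm at most t N. The increment uses two expansions
   of [fu] at x, so each may have error e / (2 N) times the norm. The summand 1 keeps N positive
   when u = v = 0. *)
pose N := `|u| + `|v| + 1.
have N0 : 0 < N by rewrite ltr_wpDl // addr_ge0.
have e'0 : 0 < e / (2 * N) by rewrite divr_gt0 // mulr_gt0.
have [_ /eqaddoP /(_ _ e'0) /nbhs_ballP[d1 /= d10 H1]] :=
  (diff_locallyP _ _).1 dfu.
have /nbhs_ballP[d2 /= d20 H2] := df.
have /nbhs_ballP[d3 /= d30 H3] := fuE.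
pose d := Num.min d1 (Num.min d2 d3).
have d0 : 0 < d by rewrite !lt_min d10 d20 d30.
have small h : `|h| < d -> [/\ differentiable f (h + x), 'D_u f (h + x) = fu (h + x)
   & `|fu (h + x) - fu x - 'd fu x h| <= e / (2 * N) * `|h|].
  rewrite !lt_min => /and3P[h1 h2 h3]; split.
  - by apply: H2; rewrite -ball_normE/= opprD addrCA subrr addr0 normrN.
  - by apply: H3; rewrite -ball_normE/= opprD addrCA subrr addr0 normrN.
  - have := H1 h; rewrite -ball_normE/= sub0r normrN => /(_ h1).
    by rewrite !fctE opprD addrA.
near=> t.
have t0 : 0 < t by near: t; exact: nbhs_right_gt.
have tt : `|t| <= t by rewrite (gtr0_norm t0).
have t00 : `|0 : R| <= t by rewrite normr0 ltW.
have tN : t * N < d.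
  rewrite -ltr_pdivlMr //; near: t; apply: nbhs_right_lt.
  by rewrite divr_gt0.
have smallst s b : 0 <= s <= t -> `|b| <= t -> `|s *: u + b *: v| <= t * (`|u| + `|v|).
  move=> /andP[s0 st] bt; apply: le_trans (ler_normD _ _) _.
  rewrite !normrZ mulrDr lerD // ler_wpM2r //.
  by rewrite ger0_norm.
have smalld h : `|h| <= t * (`|u| + `|v|) -> `|h| < d.
  move=> /le_lt_trans; apply; apply: lt_trans tN; rewrite ltr_pM2l //.
  by rewrite /N ltrDl.
pose phi s := f (s *: u + (t *: v + x)) - f (s *: u + x).
have dphi s : 0 <= s <= t -> is_derive s 1 phi
    (fu (s *: u + t *: v + x) - fu (s *: u + x)).
  move=> st.
  have [|D1 E1 _] := small (s *: u + t *: v).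
    exact/smalld/smallst.
  have [|D2 E2 _] := small (s *: u + 0 *: v).
    exact/smalld/smallst.
  rewrite scale0r addr0 in D2 E2.
  rewrite -E1 -E2 -addrA; apply: is_deriveB.
    by apply: is_derive_line; rewrite addrA.
  exact: is_derive_line.
have [s|s|s] := @MVT _ phi (fun s => fu (s *: u + t *: v + x) - fu (s *: u + x)) 0 t t0.
- by rewrite in_itv/= => /andP[s0 st]; apply: dphi; rewrite !ltW.
- apply: derivable_within_continuous => r; rewrite in_itv/= => rt.
  by have [] := dphi r rt.
rewrite in_itv/= => /andP[s0 st]; rewrite subr0 /phi => phiE.
have st' : 0 <= s <= t by rewrite !ltW.
have [|_ _ B1] := small (s *: u + t *: v).
  exact/smalld/smallst.
have [|_ _ B2] := small (s *: u + 0 *: v).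
  exact/smalld/smallst.
have n1 : `|s *: u + t *: v| <= t * N.
  apply: le_trans (smallst _ _ st' tt) _.
  by rewrite ler_pM2l // lerDl.
have n2 : `|s *: u + 0 *: v| <= t * N.
  apply: le_trans (smallst _ _ st' t00) _.
  by rewrite ler_pM2l // lerDl.
rewrite scale0r addr0 in B2 n2.
have -> : f (x + t *: u + t *: v) - f (x + t *: u) - f (x + t *: v) + f x =
    (fu (s *: u + t *: v + x) - fu (s *: u + x)) * t.
  rewrite -phiE scale0r !add0r.
  have -> : x + t *: u + t *: v = t *: u + (t *: v + x).
    by rewrite (addrC x) -addrA (addrC x).
  rewrite (addrC x (t *: u)) (addrC x (t *: v)).
  by move: (f _) (f _) (f _) (f _) => a b c d'; ring.
have BB : `|(fu (s *: u + t *: v + x) - fu (s *: u + x)) - t * 'D_v fu x| <=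
    e * t.
  have -> : (fu (s *: u + t *: v + x) - fu (s *: u + x)) - t * 'D_v fu x =
   (fu (s *: u + t *: v + x) - fu x - 'd fu x (s *: u + t *: v))
    - (fu (s *: u + x) - fu x - 'd fu x (s *: u)).
    have dtv : 'd fu x (t *: v) = t * 'D_v fu x by rewrite deriveE // linearZ.
    rewrite linearD dtv.
    by move: ('D_v fu x) ('d fu x _) (fu _) (fu _) (fu _) => A B a b d'; ring.
  apply: le_trans (ler_normB _ _) _.
  have -> : e * t = e / (2 * N) * (t * N) + e / (2 * N) * (t * N).
    by field; rewrite gt_eqF.
  apply: lerD; [apply: le_trans B1 _|apply: le_trans B2 _];
    by rewrite ler_pM2l.
have -> : (fu (s *: u + t *: v + x) - fu (s *: u + x)) * t - t ^+ 2 * 'D_v fu x =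
   t * ((fu (s *: u + t *: v + x) - fu (s *: u + x)) - t * 'D_v fu x).
  by move: ('D_v fu x) (fu _) (fu _) => A a b; ring.
rewrite normrM gtr0_norm // expr2 mulrA [leRHS]mulrC ler_pM2l //.
Unshelve. all: by end_near. Qed.

(** The second difference is symmetric in u and v, so t ^+ 2 times either mixed derivative
    approximates it up to o(t ^+ 2). Having [fu] and [fv] as separate functions lets formulas valid
    near x stand for the first derivatives. *)
Lemma derive_swap f fu fv x u v :
  (\near x, differentiable f x) ->
  (\near x, 'D_u f x = fu x) -> (\near x, 'D_v f x = fv x) ->
  differentiable fu x -> differentiable fv x -> 'D_v fu x = 'D_u fv x.
Proof.
move=> df fuE fvE dfu dfv; apply/eqP; rewrite -subr_eq0 -normr_eq0.
apply/eqP/le_anti; rewrite normr_ge0 andbT; apply/ler_addgt0Pr => e e0.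
have e20 : 0 < e / 2 by rewrite divr_gt0.
have H1 := second_difference v e20 df fuE dfu.
have H2 := second_difference u e20 df fvE dfv.
rewrite add0r; near (0 : R)^'+ => t.
have t0 : 0 < t by near: t; exact: nbhs_right_gt.
have B1 : `|f (x + t *: u + t *: v) - f (x + t *: u) - f (x + t *: v) + f x
      - t ^+ 2 * 'D_v fu x| <= e / 2 * t ^+ 2 by near: t.
have B2 : `|f (x + t *: v + t *: u) - f (x + t *: v) - f (x + t *: u) + f x
      - t ^+ 2 * 'D_u fv x| <= e / 2 * t ^+ 2 by near: t.
rewrite (addrAC x (t *: v)) in B2.
have t20 : 0 < t ^+ 2 by rewrite exprn_gt0.
rewrite -(ler_pM2l t20) -{1}(gtr0_norm t20) -normrM.
move: B1 B2; move: (f _) (f _) (f _) (f _) ('D_v _ _) ('D_u _ _) => d c b a A B B1 B2.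
have -> : t ^+ 2 * (A - B) = (a - c - b + d - t ^+ 2 * B) - (a - b - c + d - t ^+ 2 * A).
  by ring.
apply: le_trans (ler_normB _ _) _.
have -> : t ^+ 2 * e = e / 2 * t ^+ 2 + e / 2 * t ^+ 2 by field.
exact: lerD.
Unshelve. all: by end_near. Qed.

End MixedPartials.

(** * Smooth functions on open sets *)

Section Smooth.
Context {R : realType} {m : nat}.
Implicit Types (f g : 'rV[R]_m -> R) (U : set 'rV[R]_m) (x u v : 'rV[R]_m).

Lemma near_open U x (P : 'rV[R]_m -> Prop) :
  open U -> U x -> (forall y, U y -> P y) -> \near x, P x.
Proof. by move=> oU Ux HP; apply: filterS (open_nbhs_nbhs (conj oU Ux)) => y /HP. Qed.

Lemma smooth_on_differentiable U f x :
  smooth_on U f -> U x -> differentiable f x.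
Proof. by move=> sf; exact: (sf [::]). Qed.

Lemma smooth_on_pd U f i : smooth_on U f -> smooth_on U (pd i f).
Proof. by move=> sf s x Ux; have := sf (rcons s i) x Ux; rewrite foldr_rcons. Qed.

Lemma smooth_on_ext U f g : open U -> (forall x, U x -> f x = g x) ->
  smooth_on U f -> smooth_on U g.
Proof.
move=> oU fg sf s.
have E y : U y -> foldr pd f s y = foldr pd g s y.
  elim: s y => [|i s IH] y Uy /=; first exact: fg.
  exact/near_eq_derive/(near_open oU Uy).
move=> x Ux; apply: near_eq_differentiable (sf s x Ux).
exact: near_open oU Ux E.
Qed.

Lemma derive_mull (a : R) f x v : differentiable f x ->
  'D_v (fun y => a * f y) x = a * 'D_v f x.
Proof. by move=> df; exact: (deriveZ a (diff_derivable df)). Qed.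

(** Meant for derivatives along a fixed vector, which are combinations of partial derivatives with
    constant coefficients. *)
Lemma smooth_on_lincomb U n (a : 'I_n -> R) (f : 'I_n -> 'rV[R]_m -> R) :
  open U -> (forall i, smooth_on U (f i)) ->
  smooth_on U (fun x => \sum_i a i * f i x).
Proof.
move=> oU sf s.
have dsum y i t : U y -> differentiable (fun z => a i * foldr pd (f i) t z) y.
  by move=> Uy; apply/differentiable_mull/sf.
have E y : U y -> \sum_i a i * foldr pd (f i) s y =
    foldr pd (fun x => \sum_i a i * f i x) s y.
  elim: s y => [|j s IH] y Uy //=.
  have <- : pd j (fun z => \sum_i a i * foldr pd (f i) s z) y =
      pd j (foldr pd (fun x => \sum_i a i * f i x) s) y.
    exact/near_eq_derive/(near_open oU Uy).
  rewrite /pd derive_sumf; last by move=> i; exact: dsum.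
  by apply: eq_bigr => i _; rewrite derive_mull //; exact: sf.
move=> x Ux; apply: (near_eq_differentiable (near_open oU Ux E)).
by apply: differentiable_sumf => i; exact: dsum.
Qed.

Lemma smooth_on_derive U f v : open U -> smooth_on U f -> smooth_on U ('D_v f).
Proof.
move=> oU sf; apply: (@smooth_on_ext _ (fun x => \sum_i v 0 i * pd i f x)) => //.
  by move=> x Ux; rewrite derive_pd //; exact: smooth_on_differentiable Ux.
by apply: smooth_on_lincomb => // i; exact: smooth_on_pd.
Qed.

Lemma smooth_on_swap U f x u v : open U -> smooth_on U f -> U x ->
  'D_u ('D_v f) x = 'D_v ('D_u f) x.
Proof.
move=> oU sf Ux; apply: (@derive_swap _ _ f).
- by apply: near_open oU Ux _ => y; exact: smooth_on_differentiable.
- exact: filterE.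
- exact: filterE.
- exact: smooth_on_differentiable (smooth_on_derive _ oU sf) Ux.
- exact: smooth_on_differentiable (smooth_on_derive _ oU sf) Ux.
Qed.

(** Restriction to the line t |-> t v + x reduces the claim to an interior minimum of a function of
    one variable. *)
Lemma derive_eq0_at_min f x v : (\near x, differentiable f x) ->
  (\forall y \near x, f x <= f y) -> 'D_v f x = 0.
Proof.
move=> df fmin.
pose l (t : R) := t *: v + x.
have cl : l @ (0 : R) --> x.
  have -> : x = 0 *: v + x by rewrite scale0r add0r.
  by apply: cvgD; [exact: scalel_continuous|exact: cvg_cst].
have fx : \forall y \near x, differentiable f y /\ f x <= f y.
  by near=> y; split; near: y.
have [e /= e0 H] := cl _ fx.
have inl t : t \in `](- e), e[ -> differentiable f (l t) /\ f x <= f (l t).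
  by rewrite in_itv/= => te; apply: H; rewrite /= sub0r normrN ltr_norml.
have l0 : l 0 = x by rewrite /l scale0r add0r.
have d0 := @derive1_at_min R (fun t => f (l t)) (- e) e 0.
have e0' : 0 \in `](- e), e[ by rewrite in_itv/= oppr_lt0 e0.
have {}d0 : is_derive (0 : R) 1 (fun t => f (l t)) 0.
  apply: d0 => //; first by rewrite ge0_cp // ltW.
  - by move=> t /inl[dt _]; have [] := is_derive_line dt.
  - by move=> t /inl[_]; rewrite l0.
have [d00 _] := inl _ e0'.
have [_ <-] := d0.
by have [_ ->] := is_derive_line d00; rewrite -/(l 0) l0.
Unshelve. all: by end_near. Qed.

End Smooth.

(** * Curvature and connection matrices *)

(** A and B are the connection matrices along u and v. Matrices act on rows from the right, so the
    operator applied last is the last factor and the commutator reads B A - A B. *)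
Definition curvature_mx (R : realType) (V : normedModType R) m (u v : V)
    (A B : V -> 'M[R]_m) (x : V) : 'M[R]_m :=
  dmx u B x - dmx v A x + B x *m A x - A x *m B x.

Section Connection.
Context {R : realType} {m : nat}.
Implicit Types (G : symbols R m) (g : metric R m) (A B : 'rV[R]_m -> 'M[R]_m).
Implicit Types (x u v w : 'rV[R]_m).

(* The covariant derivative along a constant field u is Z |-> D_u Z + Z A_u,
   where vector fields are rows and A_u = connection_mx G u. *)
Definition connection_mx G u : 'rV[R]_m -> 'M[R]_m :=
  fun x => \matrix_(j, k) \sum_i u 0 i * G x i j k.

Lemma covariant_cst G u (Z : vfield R m) x :
  covariant G (cst u) Z x = 'D_u Z x + Z x *m connection_mx G u x.
Proof.
rewrite /covariant; congr (_ + _); apply/rowP => k; rewrite !mxE exchange_big.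
apply: eq_bigr => j _; rewrite !mxE mulr_sumr; apply: eq_bigr => i _.
by rewrite /=; ring.
Qed.

Lemma curvature_cst G u v w A B x :
  (\near x, connection_mx G u x = A x) -> (\near x, connection_mx G v x = B x) ->
  differentiable_mx A x -> differentiable_mx B x ->
  curvature G (cst u) (cst v) (cst w) x = w *m curvature_mx u v A B x.
Proof.
move=> AE BE dA dB.
have covE a C : (\near x, connection_mx G a x = C x) ->
    \near x, covariant G (cst a) (cst w) x = w *m C x.
  move=> CE; near=> y; rewrite covariant_cst derive_cst add0r.
  by rewrite (near CE y).
have dcov a b C : (\near x, connection_mx G a x = C x) -> differentiable_mx C x ->
    covariant G (cst b) (covariant G (cst a) (cst w)) x =
    w *m dmx b C x + w *m C x *m connection_mx G b x.
  move=> CE dC; have wCE := covE _ _ CE.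
  rewrite covariant_cst (near_eq_derive _ wCE) (nbhs_singleton wCE).
  have dw := differentiable_mx_cst w x.
  by rewrite derive_dmx ?dmxM ?dmx_cst ?mul0mx ?add0r //; exact: differentiable_mulmx.
rewrite /curvature; have -> : lie_bracket (cst u) (cst v) = cst 0 :> vfield R m.
  by apply/funext => y; rewrite /lie_bracket !derive_cst subrr.
rewrite (dcov v u B) // (dcov u v A) //.
rewrite covariant_cst derive0 add0r.
have -> : connection_mx G 0 x = 0.
  by apply/matrixP => j k; rewrite !mxE big1 // => i _; rewrite mxE mul0r.
rewrite mulmx0 subr0 (nbhs_singleton AE) (nbhs_singleton BE).
rewrite /curvature_mx mulmxBr mulmxDr mulmxBr !mulmxA.
by rewrite opprD addrA; congr (_ - _); rewrite addrAC.
Unshelve. all: by end_near. Qed.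

Lemma sec_curvature_mx g G u v A B x :
  (\near x, connection_mx G u x = A x) -> (\near x, connection_mx G v x = B x) ->
  differentiable_mx A x -> differentiable_mx B x ->
  sec g G x u v = (v *m curvature_mx u v A B x *m g x *m u^T) 0 0.
Proof. by move=> *; rewrite /sec (@curvature_cst _ _ _ _ A B). Qed.

Lemma connection_mx_raise g G u x :
  connection_mx (raise_index g G) u x = connection_mx G u x *m invmx (g x).
Proof.
apply/matrixP => j k; rewrite !mxE.
under [RHS]eq_bigr do rewrite !mxE mulr_suml.
rewrite exchange_big; apply: eq_bigr => i _ /=.
by rewrite mulr_sumr; apply: eq_bigr => l _; rewrite mulrA.
Qed.

(* If D_u g = A_u g + g B_u^T, i.e. the connections A and B are dual with
   respect to g, the symmetry of the second derivatives of g makes the two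
   curvatures opposite adjoints of each other. *)
Lemma curvature_mx_dual g u v (Au Av Bu Bv : 'rV[R]_m -> 'M[R]_m) x :
  (\near x, differentiable_mx g x) ->
  (\near x, dmx u g x = Au x *m g x + g x *m (Bu x)^T) ->
  (\near x, dmx v g x = Av x *m g x + g x *m (Bv x)^T) ->
  differentiable_mx Au x -> differentiable_mx Av x ->
  differentiable_mx Bu x -> differentiable_mx Bv x ->
  curvature_mx u v Au Av x *m g x = - (g x *m (curvature_mx u v Bu Bv x)^T).
Proof.
move=> dg guE gvE dAu dAv dBu dBv.
have dgx := nbhs_singleton dg.
have dhu : differentiable_mx (fun y => Au y *m g y + g y *m (Bu y)^T) x.
  by apply: differentiable_mxD; apply: differentiable_mulmx => //; apply: differentiable_trmx.
have dhv : differentiable_mx (fun y => Av y *m g y + g y *m (Bv y)^T) x.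
  by apply: differentiable_mxD; apply: differentiable_mulmx => //; apply: differentiable_trmx.
have : dmx v (fun y => Au y *m g y + g y *m (Bu y)^T) x =
       dmx u (fun y => Av y *m g y + g y *m (Bv y)^T) x.
  apply/matrixP => i j; rewrite !dmxE.
  apply: (@derive_swap _ _ (fun y => g y i j)).
  - by near=> y; exact: (near dg y).
  - by near=> y; rewrite -(near guE y) // dmxE.
  - by near=> y; rewrite -(near gvE y) // dmxE.
  - exact: dhu.
  - exact: dhv.
have dBuT := differentiable_trmx dBu; have dBvT := differentiable_trmx dBv.
rewrite !dmxD; try exact: differentiable_mulmx.
rewrite !dmxM // !dmx_tr (nbhs_singleton guE) (nbhs_singleton gvE).
have trE (a b c d : 'M[R]_m) : (a - b + c - d)^T = a^T - b^T + c^T - d^T.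
  by apply/matrixP => i j; rewrite !mxE.
rewrite /curvature_mx trE !trmx_mul !mulmxDl !mulNmx !mulmxDr !mulmxN.
rewrite !mulmxA.
move: (dmx v Au x) (dmx u Av x) (dmx v Bu x) (dmx u Bv x) => a b c d.
do 10! move: (_ *m _) => ?.
(* The cross terms A_u g B_v^T and A_v g B_u^T occur on both sides and cancel. What remains is
   linear in the other products, so it can be settled entry by entry. *)
move=> /matrixP E; apply/matrixP => i j; have := E i j; rewrite !mxE.
do 10! move: (_ i j) => ?.
by clear; lra.
Unshelve. all: by end_near. Qed.

End Connection.

(** * Cross curvature and the Levi-Civita connection of h *)

Section CrossCurvature.
Context {R : realType} {V : normedModType R} {n : nat}.
Implicit Types (C : V -> 'M[R]_n) (x p q : V).

Definition log_derivative C p : V -> 'M[R]_n :=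
  fun x => dmx p C x *m invmx (C x).

Definition cross_mx C x p q : 'M[R]_n :=
  dmx q (dmx p C) x - dmx p C x *m invmx (C x) *m dmx q C x.

Lemma differentiable_log_derivative C p x : C x \in unitmx ->
  differentiable_mx C x -> differentiable_mx (dmx p C) x ->
  differentiable_mx (log_derivative C p) x.
Proof.
by move=> uC dC ddC; apply: differentiable_mulmx => //; exact: differentiable_invmx.
Qed.

Lemma dmx_log_derivative C p q x : C x \in unitmx ->
  differentiable_mx C x -> differentiable_mx (dmx p C) x ->
  dmx q (log_derivative C p) x = cross_mx C x p q *m invmx (C x).
Proof.
move=> uC dC ddC; rewrite dmxM //; last exact: differentiable_invmx.
by rewrite dmx_invmx // mulmxN /cross_mx mulmxBl !mulmxA.
Qed.

(** Reduces the second block of the connection, built on C^T, to the same matrices S as the first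
    block. *)
Lemma cross_mx_tr C x p q : dmx q (dmx p C) x = dmx p (dmx q C) x ->
  cross_mx (fun y => (C y)^T) x q p = (cross_mx C x p q)^T.
Proof.
move=> pq; rewrite /cross_mx.
have E t : dmx t (fun y => (C y)^T) = (fun y => (dmx t C y)^T).
  by apply/funext => y; exact: dmx_tr.
rewrite !E dmx_tr -pq -trmx_inv -!trmx_mul -mulmxA.
by apply/matrixP => i j; rewrite !mxE.
Qed.

(* The components of the curvature along (p, q) and (p', q') vanish, so that
   only the mixed ones remain. *)
Lemma log_derivative_curvature C x p p' q q' : C x \in unitmx ->
  differentiable_mx C x ->
  differentiable_mx (dmx p C) x -> differentiable_mx (dmx q C) x ->
  dmx p (dmx q C) x = dmx q (dmx p C) x ->
  curvature_mx (p + p') (q + q') (log_derivative C p) (log_derivative C q) x =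
  (cross_mx C x q p' - cross_mx C x p q') *m invmx (C x).
Proof.
move=> uC dC dp dq pq; rewrite /curvature_mx.
rewrite !dmx_addv; try exact: differentiable_log_derivative.
rewrite (dmx_log_derivative p uC dC dq) (dmx_log_derivative p' uC dC dq).
rewrite (dmx_log_derivative q uC dC dp) (dmx_log_derivative q' uC dC dp).
rewrite /log_derivative.
have E s t : cross_mx C x s t *m invmx (C x) = dmx t (dmx s C) x *m invmx (C x)
    - dmx s C x *m invmx (C x) *m (dmx t C x *m invmx (C x)).
  by rewrite /cross_mx mulmxBl -!mulmxA.
(* Once the second derivatives of C agree, the products left by differentiating C^-1 are exactly the
   opposite of the commutator: logarithmic derivatives are flat along the directions that define
   them. *)
have e1 := E q p; have e2 := E p q; rewrite -pq in e2.
rewrite [RHS]mulmxBl e1 e2.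
move: (dmx p (dmx q C) x) (cross_mx C x q p') (cross_mx C x p q') => X S T.
do 5! move: (_ *m _) => ?.
by apply/matrixP => i j; rewrite !mxE; ring.
Qed.

End CrossCurvature.

(** * Polarization of biquadratic forms *)

Section Polarization.
Context {R : realType} {V V' : zmodType}.

(** Polarization in v with v' repeated comes first, then in v'. Additivity is asked of the last two
    arguments only, since the two exchange symmetries carry it to the first two. *)
Lemma polarize_biquadratic (q : V -> V' -> V -> V' -> R) (b : V -> V' -> R)
    (k : R) :
  (forall v v' w1 w2 w', q v v' (w1 + w2) w' = q v v' w1 w' + q v v' w2 w') ->
  (forall v v' w w1 w2, q v v' w (w1 + w2) = q v v' w w1 + q v v' w w2) ->
  (forall v v' w w', q v v' w w' = q w v' v w') ->
  (forall v v' w w', q v v' w w' = q v w' w v') ->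
  (forall v w v', b (v + w) v' = b v v' + b w v') ->
  (forall v v' w', b v (v' + w') = b v v' + b v w') ->
  (forall v v', q v v' v v' = 2 * k * b v v' ^+ 2) ->
  forall v v' w w', q v v' w w' = k * (b v v' * b w w' + b v w' * b w v').
Proof.
move=> qD qD' qC qC' bD bD' qq.
have q1 v w v' : q v v' w v' = 2 * k * (b v v' * b w v').
  have := qq (v + w) v'.
  rewrite qD (qC (v + w) v' v) qD (qC (v + w) v' w) qD (qC w v' v) !qq bD.
  move: (q v v' w v') (b v v') (b w v') => X y z H.
  have {}H : 2 * X = 2 * (2 * k * (y * z)).
    apply/eqP; rewrite -subr_eq0; move/eqP: H; rewrite -subr_eq0 => /eqP H.
    by apply/eqP; rewrite -[RHS]H; ring.
  exact: (mulfI (_ : 2 != 0)).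
move=> v v' w w'; have := q1 v w (v' + w').
rewrite qD' (qC' v (v' + w') w v') qD' (qC' v (v' + w') w w') qD'.
rewrite (qC' v w' w v') !q1 !bD'.
move: (q v v' w w') (b v v') (b w w') (b v w') (b w v') => X y z s t H.
have {}H : 2 * X = 2 * (k * (y * z + s * t)).
  apply/eqP; rewrite -subr_eq0; move/eqP: H; rewrite -subr_eq0 => /eqP H.
  by apply/eqP; rewrite -[RHS]H; ring.
exact: (mulfI (_ : 2 != 0)).
Qed.

End Polarization.

Lemma dmx_row (R : realType) (V : normedModType R) n p (h : 'I_n -> V -> R) x :
  dmx p (fun y => \row_j h j y) x = \row_j 'D_p (h j) x.
Proof. by apply/rowP => j; rewrite dmxE mxE; under eq_fun do rewrite mxE. Qed.

Lemma dmx_col (R : realType) (V : normedModType R) n p (h : 'I_n -> V -> R) x :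
  dmx p (fun y => \col_j h j y) x = \col_j 'D_p (h j) x.
Proof. by apply/colP => j; rewrite dmxE mxE; under eq_fun do rewrite mxE. Qed.

Lemma eq_row (T : Type) n (h h' : 'I_n -> T) : h =1 h' -> \row_j h j = \row_j h' j.
Proof. by move=> E; apply/rowP => j; rewrite !mxE E. Qed.

Lemma eq_col (T : Type) n (h h' : 'I_n -> T) : h =1 h' -> \col_j h j = \col_j h' j.
Proof. by move=> E; apply/colP => j; rewrite !mxE E. Qed.

(** * The mixed Hessian and the symmetries of S *)

Section MixedHessian.
Context {R : realType} {n : nat}.
Variables (k : 'rV[R]_(n + n) -> R) (U : set 'rV[R]_(n + n)).
Hypotheses (oU : open U) (sk : smooth_on U k).
Implicit Types (z p q : 'rV[R]_(n + n)) (v w : 'rV[R]_n).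

Definition mixed_mx z : 'M[R]_n :=
  \matrix_(i, j) pd (lshift n i) (pd (rshift n j) k) z.

Definition horizontal v : 'rV[R]_(n + n) := row_mx v 0.
Definition vertical v : 'rV[R]_(n + n) := row_mx 0 v.

Lemma horizontalD_vertical v w : horizontal v + vertical w = row_mx v w.
Proof. by rewrite /horizontal /vertical add_row_mx addr0 add0r. Qed.

Lemma smooth_mixed i j : smooth_on U (fun z => mixed_mx z i j).
Proof. by under eq_fun do rewrite mxE; do 2 apply: smooth_on_pd. Qed.

Lemma differentiable_mixed z : U z -> differentiable_mx mixed_mx z.
Proof. by move=> Uz i j; exact: smooth_on_differentiable (smooth_mixed i j) Uz. Qed.

Lemma differentiable_dmx_mixed p z : U z -> differentiable_mx (dmx p mixed_mx) z.
Proof.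
move=> Uz i j; under eq_fun do rewrite dmxE.
exact: smooth_on_differentiable (smooth_on_derive p oU (smooth_mixed i j)) Uz.
Qed.

Lemma dmx_mixed_swap p q z : U z ->
  dmx p (dmx q mixed_mx) z = dmx q (dmx p mixed_mx) z.
Proof.
move=> Uz; apply/matrixP => i j; rewrite !dmxE.
under eq_fun do rewrite dmxE; under [in RHS]eq_fun do rewrite dmxE.
exact: smooth_on_swap oU (smooth_mixed i j) Uz.
Qed.

Lemma derive_horizontal f z v : differentiable f z ->
  'D_(horizontal v) f z = \sum_i v 0 i * pd (lshift n i) f z.
Proof.
move=> df; rewrite derive_pd // big_split_ord /= [X in _ + X]big1 ?addr0.
  by apply: eq_bigr => i _; rewrite row_mxEl.
by move=> i _; rewrite row_mxEr mxE mul0r.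
Qed.

Lemma derive_vertical f z v : differentiable f z ->
  'D_(vertical v) f z = \sum_i v 0 i * pd (rshift n i) f z.
Proof.
move=> df; rewrite derive_pd // big_split_ord /= [X in X + _]big1 ?add0r.
  by apply: eq_bigr => i _; rewrite row_mxEr.
by move=> i _; rewrite row_mxEl mxE mul0r.
Qed.

Lemma mul_mixed v z : U z -> v *m mixed_mx z =
  \row_j 'D_(horizontal v) (pd (rshift n j) k) z.
Proof.
move=> Uz; apply/rowP => j; rewrite !mxE derive_horizontal; last first.
  exact: smooth_on_differentiable (smooth_on_pd (rshift n j) sk) Uz.
by apply: eq_bigr => i _; rewrite mxE.
Qed.

Lemma mixed_mul v z : U z -> mixed_mx z *m v^T =
  \col_i 'D_(vertical v) (pd (lshift n i) k) z.
Proof.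
move=> Uz; apply/colP => i; rewrite !mxE derive_vertical; last first.
  exact: smooth_on_differentiable (smooth_on_pd (lshift n i) sk) Uz.
apply: eq_bigr => j _; rewrite !mxE [LHS]mulrC.
exact: (congr1 ( *%R (v 0 j))
  (smooth_on_swap (basis_vec (lshift n i)) (basis_vec (rshift n j)) oU sk Uz)).
Qed.

(** Each entry is a derivative of a partial derivative of k along two horizontal directions, and
    these commute. *)
Lemma mul_dmx_mixed v w z : U z ->
  w *m dmx (horizontal v) mixed_mx z = v *m dmx (horizontal w) mixed_mx z.
Proof.
have E a b : U z -> b *m dmx (horizontal a) mixed_mx z =
    \row_j 'D_(horizontal a) ('D_(horizontal b) (pd (rshift n j) k)) z.
  move=> Uz.
  have <- : dmx (horizontal a) (fun y => b *m mixed_mx y) z =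
      b *m dmx (horizontal a) mixed_mx z.
    rewrite dmxM; [|exact: differentiable_mx_cst|exact: differentiable_mixed].
    by rewrite dmx_cst mul0mx add0r.
  rewrite (near_eq_dmx _ (near_open oU Uz (mul_mixed b))).
  exact: dmx_row.
move=> Uz; rewrite (E v w Uz).
rewrite (E w v Uz).
apply: eq_row => j.
exact: (smooth_on_swap (horizontal v) (horizontal w) oU (smooth_on_pd (rshift n j) sk) Uz).
Qed.

Lemma dmx_mixed_mul v w z : U z ->
  dmx (vertical v) mixed_mx z *m w^T = dmx (vertical w) mixed_mx z *m v^T.
Proof.
have E a b : U z -> dmx (vertical a) mixed_mx z *m b^T =
    \col_j 'D_(vertical a) ('D_(vertical b) (pd (lshift n j) k)) z.
  move=> Uz.
  have <- : dmx (vertical a) (fun y => mixed_mx y *m b^T) z =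
      dmx (vertical a) mixed_mx z *m b^T.
    rewrite dmxM; [|exact: differentiable_mixed|exact: differentiable_mx_cst].
    by rewrite dmx_cst mulmx0 addr0.
  rewrite (near_eq_dmx _ (near_open oU Uz (mixed_mul b))).
  exact: dmx_col.
move=> Uz; rewrite (E v w Uz).
rewrite (E w v Uz).
apply: eq_col => j.
exact: (smooth_on_swap (vertical v) (vertical w) oU (smooth_on_pd (lshift n j) sk) Uz).
Qed.

Definition cross_form z v v' w w' : R :=
  (w *m cross_mx mixed_mx z (horizontal v) (vertical v') *m w'^T) 0 0.

Definition mixed_form z v v' : R := (v *m mixed_mx z *m v'^T) 0 0.

(** The fourth-order term is treated by differentiating the identity [mul_dmx_mixed] along v'; the
    quadratic term contains one side of that identity as a factor. *)
Lemma cross_formCl z v v' w w' : U z ->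
  cross_form z v v' w w' = cross_form z w v' v w'.
Proof.
move=> Uz; rewrite /cross_form; congr ((_ *m _) 0 0).
rewrite /cross_mx !mulmxBr !mulmxA (mul_dmx_mixed v w Uz); congr (_ - _).
have E a b : a *m dmx (vertical v') (dmx (horizontal b) mixed_mx) z =
    dmx (vertical v') (fun y => a *m dmx (horizontal b) mixed_mx y) z.
  rewrite dmxM; first by rewrite dmx_cst mul0mx add0r.
    exact: differentiable_mx_cst.
  exact: differentiable_dmx_mixed.
by rewrite !E; apply: near_eq_dmx; apply: (near_open oU Uz) => y; exact: mul_dmx_mixed.
Qed.

Lemma cross_formCr z v v' w w' : U z ->
  cross_form z v v' w w' = cross_form z v w' w v'.
Proof.
move=> Uz; rewrite /cross_form -!mulmxA; congr ((_ *m _) 0 0).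
rewrite /cross_mx !mulmxBl -!mulmxA (dmx_mixed_mul v' w' Uz); congr (_ - _).
(* The derivatives are exchanged so that the vertical one is innermost, where [dmx_mixed_mul]
   applies near z. *)
have E a b : dmx (vertical a) (dmx (horizontal v) mixed_mx) z *m b^T =
    dmx (horizontal v) (fun y => dmx (vertical a) mixed_mx y *m b^T) z.
  rewrite dmxM; first by rewrite dmx_cst mulmx0 addr0 dmx_mixed_swap.
    exact: differentiable_dmx_mixed.
  exact: differentiable_mx_cst.
by rewrite !E; apply: near_eq_dmx; apply: (near_open oU Uz) => y; exact: dmx_mixed_mul.
Qed.

Lemma cross_form_polarized z kappa : U z ->
  (forall v v', cross_form z v v' v v' = 2 * kappa * mixed_form z v v' ^+ 2) ->
  forall v v' w w', cross_form z v v' w w' =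
    kappa * (mixed_form z v v' * mixed_form z w w' +
             mixed_form z v w' * mixed_form z w v').
Proof.
move=> Uz H; apply: polarize_biquadratic H.
- by move=> *; rewrite /cross_form !mulmxDl mxE.
- by move=> *; rewrite /cross_form [(_ + _)^T]linearD mulmxDr mxE.
- by move=> *; exact: cross_formCl.
- by move=> *; exact: cross_formCr.
- by move=> *; rewrite /mixed_form !mulmxDl mxE.
- by move=> *; rewrite /mixed_form [(_ + _)^T]linearD mulmxDr mxE.
Qed.

End MixedHessian.

(** * Block matrices and the Gram matrix of h *)

Section BlockDerivative.
Context {R : realType} {V : normedModType R} {n1 n2 : nat}.
Implicit Types (x p : V).

Lemma differentiable_block (A : V -> 'M[R]_n1) (D : V -> 'M[R]_n2) B C x :
  differentiable_mx A x -> differentiable_mx B x ->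
  differentiable_mx C x -> differentiable_mx D x ->
  differentiable_mx (fun y => block_mx (A y) (B y) (C y) (D y)) x.
Proof.
move=> dA dB dC dD i j.
case: (split_ordP i) => i' ->; case: (split_ordP j) => j' ->.
- by under eq_fun do rewrite block_mxEul; exact: dA.
- by under eq_fun do rewrite block_mxEur; exact: dB.
- by under eq_fun do rewrite block_mxEdl; exact: dC.
- by under eq_fun do rewrite block_mxEdr; exact: dD.
Qed.

Lemma dmx_block (A : V -> 'M[R]_n1) (D : V -> 'M[R]_n2) B C x p :
  dmx p (fun y => block_mx (A y) (B y) (C y) (D y)) x =
  block_mx (dmx p A x) (dmx p B x) (dmx p C x) (dmx p D x).
Proof.
apply/matrixP => i j; rewrite dmxE.
case: (split_ordP i) => i' ->; case: (split_ordP j) => j' ->.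
- by rewrite block_mxEul dmxE; under eq_fun do rewrite block_mxEul.
- by rewrite block_mxEur dmxE; under eq_fun do rewrite block_mxEur.
- by rewrite block_mxEdl dmxE; under eq_fun do rewrite block_mxEdl.
- by rewrite block_mxEdr dmxE; under eq_fun do rewrite block_mxEdr.
Qed.

Lemma dmxZ n m (a : R) (A : V -> 'M[R]_(n, m)) x v :
  differentiable_mx A x -> dmx v (fun y => a *: A y) x = a *: dmx v A x.
Proof.
move=> dA; apply/matrixP => i j; rewrite mxE !dmxE.
under eq_fun do rewrite mxE.
exact: (deriveZ a (diff_derivable (dA i j))).
Qed.

Lemma curvature_mx_diag (A A' : V -> 'M[R]_n1) (D D' : V -> 'M[R]_n2) x u v :
  curvature_mx u v (fun y => block_mx (A y) 0 0 (D y))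
                   (fun y => block_mx (A' y) 0 0 (D' y)) x =
  block_mx (curvature_mx u v A A' x) 0 0 (curvature_mx u v D D' x).
Proof.
rewrite /curvature_mx !dmx_block !dmx_cst !mulmx_block.
rewrite !(mul0mx, mulmx0) !addr0 !add0r.
by rewrite !(opp_block_mx, add_block_mx, oppr0, addr0).
Qed.

End BlockDerivative.

Section SplitMetric.
Context {R : realType} {n : nat}.

(** The Gram matrix of the polarization of (a, a') |-> - a A a'^T; polarizing splits the coefficient
    evenly between the two off-diagonal blocks. *)
Definition split_mx (A : 'M[R]_n) : 'M[R]_(n + n) :=
  - 2^-1 *: block_mx 0 A A^T 0.

Lemma split_mx_unit (A : 'M[R]_n) : A \in unitmx -> split_mx A \in unitmx.
Proof.
move=> uA; suff /mulmx1_unit[] : split_mx A *m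
    (- 2 *: block_mx 0 (invmx A^T) (invmx A) 0) = 1%:M by [].
rewrite -scalemxAl -scalemxAr scalerA mulmx_block.
rewrite !(mul0mx, mulmx0) !addr0 !add0r !mulmxV ?unitmx_tr // -scalar_mx_block.
by rewrite mulrNN mulVf // scale1r.
Qed.

Lemma mul_diag_split (P Q A : 'M[R]_n) :
  block_mx P 0 0 Q *m split_mx A = - 2^-1 *: block_mx 0 (P *m A) (Q *m A^T) 0.
Proof.
rewrite -scalemxAr mulmx_block.
by rewrite !(mul0mx, mulmx0) !addr0 !add0r.
Qed.

(** With A = B it evaluates the metric; with B = - A it evaluates curvature times metric, where the
    blocks are no longer transposes of each other. *)
Lemma off_diag_form (r : R) (A B : 'M[R]_n) (a a' b b' : 'rV[R]_n) :
  (row_mx a a' *m (r *: block_mx 0 A B^T 0) *m (row_mx b b')^T) 0 0 =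
  r * ((a *m A *m b'^T) 0 0 + (b *m B *m a'^T) 0 0).
Proof.
rewrite -scalemxAr -scalemxAl mxE mul_row_block tr_row_mx mul_row_col.
rewrite !mulmx0 addr0 add0r mxE addrC; congr (_ * (_ + _)).
rewrite -[RHS](_ : (b *m B *m a'^T)^T 0 0 = _); last by rewrite mxE.
by rewrite !trmx_mul trmxK mulmxA.
Qed.

Lemma split_mxE (A : 'M[R]_n) :
  ((forall i j, split_mx A (lshift n i) (lshift n j) = 0) *
   (forall i j, split_mx A (lshift n i) (rshift n j) = (- 2^-1 * A i j)%R) *
   (forall i j, split_mx A (rshift n i) (lshift n j) = (- 2^-1 * A j i)%R) *
   (forall i j, split_mx A (rshift n i) (rshift n j) = 0))%type.
Proof.
by split; [split; [split|]|]; move=> i j; rewrite mxE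
  (block_mxEul, block_mxEur, block_mxEdl, block_mxEdr) ?mxE ?mulr0.
Qed.

(* The derivatives T p = d_p C of the mixed Hessian are symmetric in their
   indices of the same kind, which kills all the Christoffel symbols of mixed
   type. *)
Lemma christoffel_split (T : 'I_(n + n) -> 'M[R]_n) (a a' : 'rV[R]_n) :
  (forall i j k, T (lshift n i) j k = T (lshift n j) i k) ->
  (forall i j k, T (rshift n i) j k = T (rshift n k) j i) ->
  \matrix_(j, k) (\sum_p row_mx a a' 0 p * (2^-1 *
     (split_mx (T p) j k + split_mx (T j) p k - split_mx (T k) p j))) =
  - 2^-1 *: block_mx 0 (\sum_i a 0 i *: T (lshift n i))
                     (\sum_i a' 0 i *: T (rshift n i))^T 0.
Proof.
move=> Tl Tr; apply/matrixP => j k; rewrite mxE big_split_ord /=.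
under eq_bigr do rewrite row_mxEl.
under [X in _ + X]eq_bigr do rewrite row_mxEr.
rewrite [RHS]mxE.
case: (split_ordP j) => j' ->; case: (split_ordP k) => k' ->.
- rewrite block_mxEul big1 ?add0r ?big1.
  + by rewrite mxE mulr0.
  + move=> i _; rewrite !split_mxE ?(Tl k' j'); ring.
  + by move=> i _; rewrite !split_mxE ?(Tl k' j'); ring.
- rewrite block_mxEur [X in _ + X]big1 ?addr0.
  + rewrite summxE mulr_sumr; apply: eq_bigr => i _.
    by rewrite !split_mxE [in RHS]mxE (Tl j' i); field.
  + move=> i _; rewrite !split_mxE ?(Tr k' j' i); ring.
- rewrite block_mxEdl [X in X + _]big1 ?add0r.
  + rewrite mxE summxE mulr_sumr; apply: eq_bigr => i _.
    by rewrite !split_mxE [in RHS]mxE (Tr j' k' i); field.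
  + move=> i _; rewrite !split_mxE ?(Tl k' i j'); ring.
- rewrite block_mxEdr big1 ?add0r ?big1.
  + by rewrite mxE mulr0.
  + by move=> i _; rewrite !split_mxE ?(Tr k' i j'); ring.
  + by move=> i _; rewrite !split_mxE ?(Tr k' i j'); ring.
Qed.

End SplitMetric.

Lemma dmx_split_mx (R : realType) (V : normedModType R) n (A : V -> 'M[R]_n) x p :
  differentiable_mx A x -> dmx p (fun y => split_mx (A y)) x = split_mx (dmx p A x).
Proof.
move=> dA; rewrite dmxZ; first by rewrite dmx_block !dmx_cst dmx_tr.
apply: (differentiable_block (A := fun=> 0) (D := fun=> 0) (C := fun y => (A y)^T)) => //.
exact: differentiable_trmx.
Qed.

(** * Levi-Civita connection and curvature of h *)

Section SplitConnection.
Context {R : realType} {n : nat}.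
Variables (k : 'rV[R]_(n + n) -> R) (U : set 'rV[R]_(n + n)).
Hypotheses (oU : open U) (sk : smooth_on U k).
Hypothesis uk : forall z, U z -> mixed_mx k z \in unitmx.
Implicit Types (z : 'rV[R]_(n + n)) (a b : 'rV[R]_n).

Local Notation C := (mixed_mx k).

Definition split_metric : metric R (n + n) := fun z => split_mx (C z).

Lemma basis_vec_lshift i :
  basis_vec (lshift n i) = horizontal (delta_mx 0 i) :> 'rV[R]_(n + n).
Proof.
apply/rowP => l; rewrite /horizontal.
by case: (split_ordP l) => j ->; rewrite ?row_mxEl ?row_mxEr !mxE
  ?(eq_lshift, eq_rshift, eq_lrshift, eq_rlshift) ?andbF.
Qed.

Lemma basis_vec_rshift i :
  basis_vec (rshift n i) = vertical (delta_mx 0 i) :> 'rV[R]_(n + n).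
Proof.
apply/rowP => l; rewrite /vertical.
by case: (split_ordP l) => j ->; rewrite ?row_mxEl ?row_mxEr !mxE
  ?(eq_lshift, eq_rshift, eq_lrshift, eq_rlshift) ?andbF.
Qed.

Lemma dmx_mixed_lC z i j l : U z ->
  dmx (basis_vec (lshift n i)) C z j l = dmx (basis_vec (lshift n j)) C z i l.
Proof.
move=> Uz; rewrite !basis_vec_lshift.
have := mul_dmx_mixed oU sk (delta_mx 0 i) (delta_mx 0 j) Uz.
by rewrite -!rowE => /rowP/(_ l); rewrite [LHS]mxE [RHS]mxE.
Qed.

Lemma dmx_mixed_rC z i j l : U z ->
  dmx (basis_vec (rshift n i)) C z j l = dmx (basis_vec (rshift n l)) C z j i.
Proof.
move=> Uz; rewrite !basis_vec_rshift.
have := dmx_mixed_mul oU sk (delta_mx 0 i) (delta_mx 0 l) Uz.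
by rewrite !trmx_delta -!colE => /colP/(_ j); rewrite [LHS]mxE [RHS]mxE.
Qed.

Lemma dmx_horizontal z a : U z ->
  dmx (horizontal a) C z = \sum_i a 0 i *: dmx (basis_vec (lshift n i)) C z.
Proof.
move=> Uz; apply/matrixP => j l; rewrite dmxE summxE derive_horizontal; last first.
  exact: (differentiable_mixed sk Uz).
by apply: eq_bigr => i _; rewrite mxE dmxE.
Qed.

Lemma dmx_vertical z a : U z ->
  dmx (vertical a) C z = \sum_i a 0 i *: dmx (basis_vec (rshift n i)) C z.
Proof.
move=> Uz; apply/matrixP => j l; rewrite dmxE summxE derive_vertical; last first.
  exact: (differentiable_mixed sk Uz).
by apply: eq_bigr => i _; rewrite mxE dmxE.
Qed.

Lemma levi_civita_first_split z i j l : U z ->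
  levi_civita_first split_metric z i j l =
  2^-1 * (split_mx (dmx (basis_vec i) C z) j l
        + split_mx (dmx (basis_vec j) C z) i l
        - split_mx (dmx (basis_vec l) C z) i j).
Proof.
move=> Uz; have pdE p s t : pd p (fun y => split_metric y s t) z =
    split_mx (dmx (basis_vec p) C z) s t.
  rewrite -dmx_split_mx; last exact: (differentiable_mixed sk Uz).
  by rewrite dmxE.
by rewrite /levi_civita_first (pdE i) (pdE j) (pdE l).
Qed.

Lemma connection_mx_split z a a' : U z ->
  connection_mx (levi_civita split_metric) (row_mx a a') z =
  block_mx (log_derivative C (horizontal a) z) 0
         0 (log_derivative (fun y => (C y)^T) (vertical a') z).
Proof.
move=> Uz; rewrite connection_mx_raise.
have -> : connection_mx (levi_civita_first split_metric) (row_mx a a') z =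
    - 2^-1 *: block_mx 0 (dmx (horizontal a) C z) (dmx (vertical a') C z)^T 0.
  rewrite dmx_horizontal // dmx_vertical //.
  rewrite -(christoffel_split (T := fun p => dmx (basis_vec p) C z)).
  - apply/matrixP => j l; rewrite [LHS]mxE [RHS]mxE; apply: eq_bigr => p _.
    by rewrite levi_civita_first_split.
  - by move=> i j l; exact: dmx_mixed_lC.
  - by move=> i j l; exact: dmx_mixed_rC.
have uCz := uk Uz.
(* Inserting the metric and its inverse on the right reduces the equality to lowered indices, where
   both factors C^-1 cancel. *)
rewrite -[RHS](mulmxK (split_mx_unit uCz)) mul_diag_split /log_derivative.
by rewrite !mulmxKV ?unitmx_tr // dmx_tr.
Qed.

(** Each diagonal block of the curvature contributes two of the four terms; multiplication by the
    metric cancels the factor C^-1 or C^-T of the block. *)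
Lemma sec_split z a a' b b' : U z ->
  sec split_metric (levi_civita split_metric) z (row_mx a a') (row_mx b b') =
  - 2^-1 * (cross_form k z b a' b a' - cross_form k z a b' b a'
          + cross_form k z a b' a b' - cross_form k z b a' a b').
Proof.
move=> Uz; have uCz := uk Uz; have dC := differentiable_mixed sk Uz.
have ddC p := differentiable_dmx_mixed oU sk p Uz.
pose CT y := (C y)^T.
have uCT : CT z \in unitmx by rewrite unitmx_tr.
have dCT : differentiable_mx CT z by exact: differentiable_trmx.
have ddCT p : differentiable_mx (dmx p CT) z.
  have -> : dmx p CT = fun y => (dmx p C y)^T.
    by apply/funext => y; exact: dmx_tr.
  exact: differentiable_trmx.
have swap p q := dmx_mixed_swap oU sk p q Uz.
have swapT p q : dmx p (dmx q CT) z = dmx q (dmx p CT) z.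
  have E s : dmx s CT = fun y => (dmx s C y)^T.
    by apply/funext => y; exact: dmx_tr.
  by rewrite (E p) (E q) (dmx_tr p (dmx q C)) (dmx_tr q (dmx p C)) (swap p q).
pose A s s' y := block_mx (log_derivative C (horizontal s) y) 0
                   0 (log_derivative CT (vertical s') y) : 'M[R]_(n + n).
have AE s s' : \near z, connection_mx (levi_civita split_metric) (row_mx s s') z = A s s' z.
  by apply: (near_open oU Uz) => y; exact: connection_mx_split.
have dA s s' : differentiable_mx (A s s') z.
  apply: differentiable_block; try exact: differentiable_mx_cst.
    exact: differentiable_log_derivative.
  exact: differentiable_log_derivative.
rewrite (sec_curvature_mx _ (AE a a') (AE b b') (dA a a') (dA b b')).
have -> : curvature_mx (row_mx a a') (row_mx b b') (A a a') (A b b') z =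
  block_mx ((cross_mx C z (horizontal b) (vertical a') -
             cross_mx C z (horizontal a) (vertical b')) *m invmx (C z)) 0 0
   ((cross_mx C z (horizontal a) (vertical b') -
     cross_mx C z (horizontal b) (vertical a'))^T *m invmx (CT z)).
  rewrite curvature_mx_diag.
  have -> : curvature_mx (row_mx a a') (row_mx b b')
      (log_derivative C (horizontal a)) (log_derivative C (horizontal b)) z =
      (cross_mx C z (horizontal b) (vertical a') -
             cross_mx C z (horizontal a) (vertical b')) *m invmx (C z).
    by rewrite -(horizontalD_vertical a a') -(horizontalD_vertical b b')
      log_derivative_curvature.
  (* In the lower block the vertical components are the flat directions, so the sums are commuted
     before [log_derivative_curvature] is used for C^T. *)
  have -> : curvature_mx (row_mx a a') (row_mx b b')
      (log_derivative CT (vertical a')) (log_derivative CT (vertical b')) z =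
      (cross_mx CT z (vertical b') (horizontal a) -
             cross_mx CT z (vertical a') (horizontal b)) *m invmx (CT z).
    by rewrite -(horizontalD_vertical a a') -(horizontalD_vertical b b')
      addrC (addrC (horizontal b)) log_derivative_curvature.
  rewrite (cross_mx_tr (swap (vertical b') (horizontal a))).
  rewrite (cross_mx_tr (swap (vertical a') (horizontal b))).
  by congr (block_mx _ _ _ (_ *m _)); rewrite [RHS]linearB.
rewrite -(mulmxA (row_mx b b')) mul_diag_split !mulmxKV ?unitmx_tr //.
rewrite off_diag_form /cross_form.
have E (v w : 'rV[R]_n) (S T : 'M[R]_n) : (v *m (S - T) *m w^T) 0 0 =
    (v *m S *m w^T) 0 0 - (v *m T *m w^T) 0 0.
  by rewrite mulmxBr mulmxBl [LHS]mxE [X in _ + X]mxE.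
by rewrite (E b a') (E a b') addrA.
Qed.

Lemma split_metric_form z a a' b b' :
  inner split_metric z (row_mx a a') (row_mx b b') =
  - 2^-1 * (mixed_form k z a b' + mixed_form k z b a').
Proof. exact: off_diag_form. Qed.

End SplitConnection.

(** * Graphs in coordinates *)

Section MixedForm.
Context {R : realType} {n : nat}.
Variables (k : 'rV[R]_(n + n) -> R) (U : set 'rV[R]_(n + n)).
Hypotheses (oU : open U) (sk : smooth_on U k).
Implicit Types (z p : 'rV[R]_(n + n)) (v w : 'rV[R]_n).

Lemma mixed_formE z v w : U z ->
  mixed_form k z v w = 'D_(horizontal v) ('D_(vertical w) k) z.
Proof.
move=> Uz; have sv := smooth_on_derive (horizontal v) oU sk.
rewrite (smooth_on_swap (horizontal v) (vertical w) oU sk Uz).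
rewrite (derive_vertical w (smooth_on_differentiable sv Uz)).
rewrite /mixed_form (mul_mixed sk v Uz) mxE; apply: eq_bigr => j _.
rewrite [w^T _ _]mxE [LHS]mulrC mxE.
exact: (congr1 ( *%R (w 0 j))
  (smooth_on_swap (horizontal v) (basis_vec (rshift n j)) oU sk Uz)).
Qed.

Lemma dmx_mixed_form z p v w : U z ->
  (v *m dmx p (mixed_mx k) z *m w^T) 0 0 =
  'D_p ('D_(horizontal v) ('D_(vertical w) k)) z.
Proof.
move=> Uz; have dC := differentiable_mixed sk Uz.
have -> : v *m dmx p (mixed_mx k) z *m w^T =
    dmx p (fun y => v *m mixed_mx k y *m w^T) z.
  have dv := differentiable_mx_cst v z; have dw := differentiable_mx_cst w^T z.
  rewrite dmxM ?dmx_cst; [|exact: differentiable_mulmx|by []].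
  by rewrite dmxM // dmx_cst mulmx0 addr0 mul0mx add0r.
rewrite dmxE; apply: near_eq_derive; apply: (near_open oU Uz) => y Uy.
exact: mixed_formE.
Qed.

End MixedForm.

Lemma delta_mx_form (R : realType) n (A : 'M[R]_n) i j :
  ((delta_mx 0 i : 'rV_n) *m A *m (delta_mx 0 j : 'rV_n)^T) 0 0 = A i j.
Proof. by rewrite -rowE trmx_delta -colE !mxE. Qed.

Lemma derive_subc (R : realType) (V : normedModType R) (f : V -> R) (e : R) x v :
  differentiable f x -> 'D_v (fun y => f y - e) x = 'D_v f x.
Proof.
move=> df.
have := @deriveB _ _ _ f (cst e) x v (diff_derivable df) (derivable_cst _ _ _).
by rewrite derive_cst subr0.
Qed.

Lemma dmx_row_mx (R : realType) (V : normedModType R) n1 n2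
    (A : V -> 'rV[R]_n1) (B : V -> 'rV[R]_n2) x v :
  dmx v (fun y => row_mx (A y) (B y)) x = row_mx (dmx v A x) (dmx v B x).
Proof.
apply/rowP => i; rewrite dmxE; case: (split_ordP i) => j ->.
  by rewrite row_mxEl dmxE; under eq_fun do rewrite row_mxEl.
by rewrite row_mxEr dmxE; under eq_fun do rewrite row_mxEr.
Qed.

Lemma differentiable_row_mx (R : realType) (V : normedModType R) n1 n2
    (A : V -> 'rV[R]_n1) (B : V -> 'rV[R]_n2) x :
  differentiable_mx A x -> differentiable_mx B x ->
  differentiable_mx (fun y => row_mx (A y) (B y)) x.
Proof.
move=> dA dB i j; case: (split_ordP j) => l ->.
  by under eq_fun do rewrite row_mxEl; exact: dA.
by under eq_fun do rewrite row_mxEr; exact: dB.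
Qed.

Lemma differentiable_mx_id (R : realType) n (x : 'rV[R]_n) :
  differentiable_mx (fun y => y) x.
Proof. by move=> i j; exact: differentiable_coord. Qed.

Lemma dmx_id (R : realType) n (x v : 'rV[R]_n) : dmx v (fun y => y) x = v.
Proof.
by rewrite -derive_dmx ?derive_id //; exact: differentiable_mx_id.
Qed.

(** * Dualistic structure of a graph given by a local map F *)

Section Graph.
Context {R : realType} {n : nat}.
Variables (k : 'rV[R]_(n + n) -> R) (U : set 'rV[R]_(n + n)).
Hypotheses (oU : open U) (sk : smooth_on U k).
Variables (F : 'rV[R]_n -> 'rV[R]_n) (W : set 'rV[R]_n).
Hypotheses (oW : open W) (sF : forall j, smooth_on W (fun y => F y 0 j)).
(** The divergence pairs a point with the image of another one, so k must be smooth at all pairs,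
    also off the graph. *)
Hypothesis UF : forall y y', W y -> W y' -> U (row_mx y (F y')).
Implicit Types (x y v w : 'rV[R]_n).

Local Notation C := (mixed_mx k).

Definition jac y : 'M[R]_n := \matrix_(i, j) pd i (fun y => F y 0 j) y.

Definition graph_pt y : 'rV[R]_(n + n) := row_mx y (F y).

Lemma differentiable_F y : W y -> differentiable_mx F y.
Proof.
by move=> Wy i j; rewrite ord1; exact: smooth_on_differentiable (sF j) Wy.
Qed.

Lemma dmx_F v y : W y -> dmx v F y = v *m jac y.
Proof.
move=> Wy; apply/rowP => j; rewrite dmxE derive_pd; last exact: differentiable_F.
by rewrite mxE; apply: eq_bigr => i _; rewrite mxE.
Qed.

Lemma smooth_jac i j : smooth_on W (fun y => jac y i j).
Proof. by under eq_fun do rewrite mxE; exact: smooth_on_pd. Qed.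

Lemma differentiable_jac y : W y -> differentiable_mx jac y.
Proof. by move=> Wy i j; exact: smooth_on_differentiable (smooth_jac i j) Wy. Qed.

Lemma differentiable_dmx_jac v y : W y -> differentiable_mx (dmx v jac) y.
Proof.
move=> Wy i j; under eq_fun do rewrite dmxE.
exact: smooth_on_differentiable (smooth_on_derive v oW (smooth_jac i j)) Wy.
Qed.

Lemma U_graph_pt y : W y -> U (graph_pt y).
Proof. by move=> Wy; exact: UF. Qed.

Lemma differentiable_graph_pt y : W y -> differentiable_mx graph_pt y.
Proof.
by move=> Wy; apply: differentiable_row_mx;
  [exact: differentiable_mx_id|exact: differentiable_F].
Qed.

Lemma dmx_graph_pt v y : W y -> dmx v graph_pt y = row_mx v (v *m jac y).
Proof. by move=> Wy; rewrite dmx_row_mx dmx_id dmx_F. Qed.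

Lemma derive_fst (f : 'rV[R]_(n + n) -> R) v y y' : W y -> W y' ->
  differentiable f (row_mx y (F y')) ->
  'D_v (fun y => f (row_mx y (F y'))) y = 'D_(horizontal v) f (row_mx y (F y')).
Proof.
move=> Wy Wy' df.
rewrite (@derive_comp_row _ _ _ (fun y => row_mx y (F y'))) //.
  by rewrite dmx_row_mx dmx_id dmx_cst.
by apply: differentiable_row_mx; [exact: differentiable_mx_id|exact: differentiable_mx_cst].
Qed.

Lemma derive_snd (f : 'rV[R]_(n + n) -> R) v y y' : W y -> W y' ->
  differentiable f (row_mx y (F y')) ->
  'D_v (fun y' => f (row_mx y (F y'))) y' =
  'D_(vertical (v *m jac y')) f (row_mx y (F y')).
Proof.
move=> Wy Wy' df.
rewrite (@derive_comp_row _ _ _ (fun y' => row_mx y (F y'))) //.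
  by rewrite dmx_row_mx dmx_cst dmx_F.
by apply: differentiable_row_mx; [exact: differentiable_mx_cst|exact: differentiable_F].
Qed.

Lemma derive_graph_pt (f : 'rV[R]_(n + n) -> R) v y : W y -> differentiable f (graph_pt y) ->
  'D_v (fun y => f (graph_pt y)) y = 'D_(row_mx v (v *m jac y)) f (graph_pt y).
Proof.
move=> Wy df; rewrite (derive_comp_row v (differentiable_graph_pt Wy) df).
by rewrite dmx_graph_pt.
Qed.

Lemma smooth_on_pt (f : 'rV[R]_(n + n) -> R) y y' : smooth_on U f -> W y -> W y' ->
  differentiable f (row_mx y (F y')).
Proof. by move=> sf Wy Wy'; exact: smooth_on_differentiable sf (UF Wy Wy'). Qed.

Lemma differentiable_fst (f : 'rV[R]_(n + n) -> R) y y' :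
  smooth_on U f -> W y -> W y' -> differentiable (fun y => f (row_mx y (F y'))) y.
Proof.
move=> sf Wy Wy'; apply: (@differentiable_comp _ _ _ _ (fun y => row_mx y (F y')) f).
  apply: differentiable_mx_differentiable.
  by apply: differentiable_row_mx; [exact: differentiable_mx_id|exact: differentiable_mx_cst].
exact: smooth_on_pt.
Qed.

Lemma differentiable_snd (f : 'rV[R]_(n + n) -> R) y y' :
  smooth_on U f -> W y -> W y' -> differentiable (fun y' => f (row_mx y (F y'))) y'.
Proof.
move=> sf Wy Wy'; apply: (@differentiable_comp _ _ _ _ (fun y' => row_mx y (F y')) f).
  apply: differentiable_mx_differentiable.
  by apply: differentiable_row_mx; [exact: differentiable_mx_cst|exact: differentiable_F].
exact: smooth_on_pt.
Qed.

Variables (ph : 'rV[R]_n -> R) (D : 'rV[R]_n -> 'rV[R]_n -> R).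
Hypothesis sph : smooth_on W ph.
(** The parenthesis is the c-transform at F y'. Optimality of the transport enters this section
    through this formula and [D0]. *)
Hypothesis DE : forall y y', W y -> W y' ->
  D y y' = k (row_mx y (F y')) - ph y - (k (graph_pt y') - ph y').
Hypothesis D0 : forall y y', W y -> W y' -> 0 <= D y y'.

Lemma derive_potential v y : W y -> 'D_(horizontal v) k (graph_pt y) = 'D_v ph y.
Proof.
move=> Wy; have dk := smooth_on_pt sk Wy Wy.
have dky' y' : W y' -> differentiable (fun y' => k (row_mx y' (F y))) y'.
  by move=> Wy'; exact: differentiable_fst.
have dph y' : W y' -> differentiable ph y' by exact: smooth_on_differentiable.
have : 'D_v (fun y' => k (row_mx y' (F y)) - ph y') y = 0.
  apply: derive_eq0_at_min.
    by apply: (near_open oW Wy) => y' Wy'; exact: differentiableB (dky' _ Wy') (dph _ Wy').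
  apply: (near_open oW Wy) => y' Wy'.
  by rewrite -subr_ge0; move: (D0 Wy' Wy); rewrite DE.
rewrite (deriveB (diff_derivable (dky' _ Wy)) (diff_derivable (dph _ Wy))).
by rewrite derive_fst // => /eqP; rewrite subr_eq0 => /eqP.
Qed.

(** Differentiating [derive_potential] along the graph writes the Hessian of [ph] as the horizontal
    Hessian of k plus this form; both Hessians are symmetric. *)
Lemma mixed_form_jacC v w y : W y ->
  mixed_form k (graph_pt y) v (w *m jac y) = mixed_form k (graph_pt y) w (v *m jac y).
Proof.
move=> Wy; have Uy := U_graph_pt Wy.
have E a b : 'D_a ('D_b ph) y = 'D_(horizontal a) ('D_(horizontal b) k) (graph_pt y)
    + mixed_form k (graph_pt y) b (a *m jac y).
  have sb := smooth_on_derive (horizontal b) oU sk.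
  rewrite (mixed_formE oU sk _ _ Uy).
  rewrite (smooth_on_swap (horizontal b) (vertical (a *m jac y)) oU sk Uy).
  have <- : 'D_a (fun y => 'D_(horizontal b) k (graph_pt y)) y = 'D_a ('D_b ph) y.
    by apply: near_eq_derive; apply: (near_open oW Wy) => y' Wy'; exact: derive_potential.
  have db := smooth_on_differentiable sb Uy.
  by rewrite (derive_graph_pt a Wy db) -horizontalD_vertical (derive_addv _ _ db).
have := smooth_on_swap v w oW sph Wy.
rewrite (E v w) (E w v) (smooth_on_swap (horizontal v) (horizontal w) oU sk Uy).
by move=> /addrI.
Qed.

(** The subtracted term is independent of y, hence disappears in every further derivative with
    respect to the first argument. *)
Lemma pd_snd y x i : W y -> W x -> pd i (fun y' => D y y') x =
  'D_(vertical (basis_vec i *m jac x)) k (row_mx y (F x))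
  - 'D_(basis_vec i) (fun y' => k (graph_pt y') - ph y') x.
Proof.
move=> Wy Wx.
have dgr y' : W y' -> differentiable (fun y' => k (graph_pt y')) y'.
  move=> Wy'; apply: (@differentiable_comp _ _ _ _ graph_pt).
    exact/differentiable_mx_differentiable/differentiable_graph_pt.
  exact: smooth_on_pt.
have dsnd := differentiable_snd sk Wy Wx.
have d1 : differentiable (fun y' => k (row_mx y (F y')) - ph y) x.
  exact: differentiableB dsnd (differentiable_cst _ _).
have d2 : differentiable (fun y' => k (graph_pt y') - ph y') x.
  exact: differentiableB (dgr _ Wx) (smooth_on_differentiable sph Wx).
rewrite /pd (near_eq_derive _ (near_open oW Wx (fun y' Wy' => DE Wy Wy'))).
rewrite (deriveB (diff_derivable d1) (diff_derivable d2)).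
rewrite (derive_subc _ _ dsnd) derive_snd //.
exact: smooth_on_pt.
Qed.

Lemma pd_fst y x i : W y -> W x -> pd i (fun y => D y x) y =
  'D_(horizontal (basis_vec i)) k (row_mx y (F x)) - 'D_(basis_vec i) ph y.
Proof.
move=> Wy Wx.
have dfst := differentiable_fst sk Wy Wx.
have dph := smooth_on_differentiable sph Wy.
have d1 : differentiable (fun y => k (row_mx y (F x)) - ph y) y.
  exact: differentiableB dfst dph.
rewrite /pd (near_eq_derive _ (near_open oW Wy (fun y' Wy' => DE Wy' Wx))).
rewrite (derive_subc _ _ d1) (deriveB (diff_derivable dfst) (diff_derivable dph)).
by rewrite derive_fst //; exact: smooth_on_pt.
Qed.

Definition graph_metric y : 'M[R]_n := - (C (graph_pt y) *m (jac y)^T).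

Lemma graph_metric_form y i j :
  - graph_metric y i j =
  mixed_form k (graph_pt y) (delta_mx 0 i) (delta_mx 0 j *m jac y).
Proof.
rewrite /graph_metric mxE opprK -[LHS]delta_mx_form /mixed_form.
by rewrite trmx_mul !mulmxA.
Qed.

Lemma graph_metric_sym y : W y -> (graph_metric y)^T = graph_metric y.
Proof.
move=> Wy; apply/matrixP => i j; rewrite mxE; apply: oppr_inj.
by rewrite !graph_metric_form mixed_form_jacC.
Qed.

Lemma div_metricE x : W x -> div_metric D x = graph_metric x.
Proof.
move=> Wx; apply/matrixP => i j; rewrite mxE; apply: oppr_inj; rewrite opprK.
rewrite graph_metric_form (mixed_formE oU sk _ _ (U_graph_pt Wx)).
rewrite /pd (near_eq_derive _ (near_open oW Wx (fun y Wy => pd_snd j Wy Wx))).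
have sh := smooth_on_derive (vertical (basis_vec j *m jac x)) oU sk.
rewrite (derive_subc _ _ (differentiable_fst sh Wx Wx)).
exact: (derive_fst _ Wx Wx (smooth_on_pt sh Wx Wx)).
Qed.

Lemma div_primal_firstE x i j l : W x ->
  div_primal_first D x i j l =
  - (dmx (horizontal (basis_vec i)) C (graph_pt x) *m (jac x)^T) j l.
Proof.
move=> Wx; rewrite /div_primal_first; congr (- _).
set h := 'D_(vertical (basis_vec l *m jac x)) k.
have sh : smooth_on U h := smooth_on_derive (vertical (basis_vec l *m jac x)) oU sk.
have sjh : smooth_on U ('D_(horizontal (basis_vec j)) h).
  exact: smooth_on_derive.
have E y : W y -> pd j (fun y => pd l (fun y' => D y y') x) y =
    'D_(horizontal (basis_vec j)) h (row_mx y (F x)).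
  move=> Wy; rewrite /pd (near_eq_derive _ (near_open oW Wy (fun y Wy => pd_snd l Wy Wx))).
  rewrite (derive_subc _ _ (differentiable_fst sh Wy Wx)).
  exact: (derive_fst _ Wy Wx (smooth_on_pt sh Wy Wx)).
rewrite /pd (near_eq_derive _ (near_open oW Wx E)).
rewrite (derive_fst _ Wx Wx (smooth_on_pt sjh Wx Wx)).
rewrite -(dmx_mixed_form oU sk _ _ _ (U_graph_pt Wx)) trmx_mul.
by rewrite -[RHS]delta_mx_form !mulmxA.
Qed.

Lemma connection_mx_primal_first u x : W x ->
  connection_mx (div_primal_first D) u x =
  - (dmx (horizontal u) C (graph_pt x) *m (jac x)^T).
Proof.
move=> Wx; apply/matrixP => j l; rewrite mxE.
rewrite (dmx_horizontal sk _ (U_graph_pt Wx)) mulmx_suml mxE summxE -sumrN.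
apply: eq_bigr => i _; rewrite div_primal_firstE // basis_vec_lshift.
by rewrite -scalemxAl [in RHS]mxE mulrN.
Qed.

Lemma dmx_snd u x y : W x -> W y ->
  dmx u (fun y => C (row_mx x (F y))) y =
  dmx (vertical (u *m jac y)) C (row_mx x (F y)).
Proof.
move=> Wx Wy; rewrite (@dmx_comp _ _ _ _ _ (fun y => row_mx x (F y))).
- by rewrite dmx_row_mx dmx_F // dmx_cst.
- by apply: differentiable_row_mx; [exact: differentiable_mx_cst|exact: differentiable_F].
- exact/(differentiable_mixed sk)/UF.
Qed.

Lemma differentiable_C_snd x y : W x -> W y ->
  differentiable_mx (fun y => C (row_mx x (F y))) y.
Proof.
move=> Wx Wy; apply: (@differentiable_mx_comp _ _ _ _ _ (fun y => row_mx x (F y))).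
  by apply: differentiable_row_mx; [exact: differentiable_mx_cst|exact: differentiable_F].
exact/(differentiable_mixed sk)/UF.
Qed.

Lemma differentiable_C_graph y : W y -> differentiable_mx (fun y => C (graph_pt y)) y.
Proof.
move=> Wy; apply: differentiable_mx_comp; first exact: differentiable_graph_pt.
exact/(differentiable_mixed sk)/U_graph_pt.
Qed.

(* The derivative along u of the second argument of
   - C(x, F y) J(y)^T, the mixed derivative of the divergence. *)
Definition dual_first_mx u y : 'M[R]_n :=
  - (dmx (vertical (u *m jac y)) C (graph_pt y) *m (jac y)^T
     + C (graph_pt y) *m (dmx u jac y)^T).

Lemma dmx_snd_jac u x : W x ->
  dmx u (fun y => C (row_mx x (F y)) *m (jac y)^T) x = - dual_first_mx u x.
Proof.
move=> Wx; rewrite dmxM; [|exact: differentiable_C_snd|].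
  by rewrite dmx_snd // dmx_tr opprK.
exact/differentiable_trmx/differentiable_jac.
Qed.

Lemma div_dual_firstE x i j l : W x ->
  div_dual_first D x i j l = dual_first_mx (basis_vec i) x l j.
Proof.
move=> Wx; apply: oppr_inj; rewrite /div_dual_first opprK.
have -> : - dual_first_mx (basis_vec i) x l j = (- dual_first_mx (basis_vec i) x) l j.
  by rewrite [RHS]mxE.
rewrite -dmx_snd_jac // dmxE.
have sl := smooth_on_derive (horizontal (basis_vec l)) oU sk.
apply: near_eq_derive; apply: (near_open oW Wx) => y Wy.
rewrite /pd (near_eq_derive _ (near_open oW Wy (fun y Wy => pd_fst l Wx Wy))).
rewrite (derive_subc _ _ (differentiable_snd sl Wx Wy)).
rewrite (derive_snd _ Wx Wy (smooth_on_pt sl Wx Wy)).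
rewrite (smooth_on_swap _ _ oU sk (UF Wx Wy)).
rewrite -(mixed_formE oU sk _ _ (UF Wx Wy)) /mixed_form trmx_mul.
by rewrite -[RHS]delta_mx_form !mulmxA.
Qed.

Lemma differentiable_snd_jac x y : W x -> W y ->
  differentiable_mx (fun y => C (row_mx x (F y)) *m (jac y)^T) y.
Proof.
move=> Wx Wy; apply: differentiable_mulmx; first exact: differentiable_C_snd.
exact/differentiable_trmx/differentiable_jac.
Qed.

(** The transpose appears because the last index of a dual symbol belongs to the first argument of
    the divergence, that is, to the rows of C. *)
Lemma connection_mx_dual_first u x : W x ->
  connection_mx (div_dual_first D) u x = (dual_first_mx u x)^T.
Proof.
move=> Wx; apply/matrixP => j l; rewrite mxE [RHS]mxE.
have E v : dual_first_mx v x l j =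
    - 'D_v (fun y => (C (row_mx x (F y)) *m (jac y)^T) l j) x.
  by rewrite -dmxE dmx_snd_jac // [in RHS]mxE opprK.
(* Reading the matrix as a directional derivative of C J^T yields its linearity in the direction at
   once. *)
rewrite E derive_pd; last exact: differentiable_snd_jac.
rewrite -sumrN; apply: eq_bigr => i _.
by rewrite div_dual_firstE // E mulrN.
Qed.

Lemma differentiable_graph_metric y : W y -> differentiable_mx graph_metric y.
Proof.
move=> Wy; apply: differentiable_mxN; apply: differentiable_mulmx.
  exact: differentiable_C_graph.
exact/differentiable_trmx/differentiable_jac.
Qed.

(** The duality of the two connections with lowered indices: by the chain rule, moving along the
    graph moves the first argument (primal term) and the second one (dual term). *)
Lemma dmx_graph_metric u y : W y -> dmx u graph_metric y =
  - (dmx (horizontal u) C (graph_pt y) *m (jac y)^T) + dual_first_mx u y.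
Proof.
move=> Wy; have dC := differentiable_C_graph Wy.
have dJ := differentiable_trmx (differentiable_jac Wy).
have dCU := differentiable_mixed sk (U_graph_pt Wy).
rewrite (dmxN _ (differentiable_mulmx dC dJ)) (dmxM _ dC dJ) dmx_tr.
rewrite (dmx_comp u (differentiable_graph_pt Wy) dCU) (dmx_graph_pt u Wy).
rewrite -horizontalD_vertical (dmx_addv _ _ dCU) mulmxDl.
by rewrite /dual_first_mx -opprD addrA.
Qed.

Lemma differentiable_dual_first_mx u y : W y -> differentiable_mx (dual_first_mx u) y.
Proof.
move=> Wy; apply: differentiable_mxN; apply: differentiable_mxD; last first.
  apply: differentiable_mulmx; first exact: differentiable_C_graph.
  exact/differentiable_trmx/differentiable_dmx_jac.
apply: differentiable_mulmx; last exact/differentiable_trmx/differentiable_jac.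
(* The direction u J(y) varies with y, so it is expanded over constant directions before
   differentiating. *)
apply: (@near_eq_differentiable_mx _ _ _ _ (fun y => \sum_i (u *m jac y) 0 i
    *: dmx (basis_vec (rshift n i)) C (graph_pt y))).
  apply: (near_open oW Wy) => x Wx.
  by rewrite (dmx_vertical sk _ (U_graph_pt Wx)).
move=> i j; under eq_fun do rewrite summxE.
apply: differentiable_sumf => l; under eq_fun do rewrite mxE.
apply: (@differentiableM _ _ (fun x => (u *m jac x) 0 l)).
  apply: differentiable_mulmx; first exact: differentiable_mx_cst.
  exact: differentiable_jac.
apply: (@differentiable_mx_comp _ _ _ _ _ graph_pt); first exact: differentiable_graph_pt.
exact: (differentiable_dmx_mixed oU sk _ (U_graph_pt Wy)).
Qed.

Hypothesis uk : forall z, U z -> C z \in unitmx.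
Hypothesis uJ : forall y, W y -> jac y \in unitmx.

Lemma graph_metric_unit y : W y -> graph_metric y \in unitmx.
Proof.
move=> Wy; rewrite /graph_metric -scaleN1r unitmxZ ?unitrN1 //.
rewrite unitmx_mul unitmx_tr uJ // andbT.
exact/uk/U_graph_pt.
Qed.

Lemma mul_log_derivative_metric u y : W y ->
  log_derivative C (horizontal u) (graph_pt y) *m graph_metric y =
  - (dmx (horizontal u) C (graph_pt y) *m (jac y)^T).
Proof.
move=> Wy; rewrite /log_derivative /graph_metric mulmxN mulmxA mulmxKV //.
exact/uk/U_graph_pt.
Qed.

Lemma connection_mx_primal u y : W y -> connection_mx (div_primal D) u y =
  log_derivative C (horizontal u) (graph_pt y).
Proof.
move=> Wy; rewrite connection_mx_raise connection_mx_primal_first // div_metricE //.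
by rewrite -mul_log_derivative_metric // mulmxK // graph_metric_unit.
Qed.

Definition dual_connection_mx u y := (dual_first_mx u y)^T *m invmx (graph_metric y).

Lemma connection_mx_dual u y : W y -> connection_mx (div_dual D) u y =
  dual_connection_mx u y.
Proof.
by move=> Wy; rewrite connection_mx_raise connection_mx_dual_first // div_metricE.
Qed.

Let primal u y := log_derivative C (horizontal u) (graph_pt y).

Lemma differentiable_log_graph u y : W y ->
  differentiable_mx (log_derivative C (horizontal u)) (graph_pt y).
Proof.
move=> Wy; have Uy := U_graph_pt Wy; apply: differentiable_log_derivative.
- exact: uk.
- exact: (differentiable_mixed sk Uy).
- exact: (differentiable_dmx_mixed oU sk _ Uy).
Qed.

Lemma differentiable_primal u y : W y -> differentiable_mx (primal u) y.
Proof.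
move=> Wy; apply: differentiable_mx_comp; first exact: differentiable_graph_pt.
exact: differentiable_log_graph.
Qed.

Lemma differentiable_dual u y : W y -> differentiable_mx (dual_connection_mx u) y.
Proof.
move=> Wy; apply: differentiable_mulmx.
  exact/differentiable_trmx/differentiable_dual_first_mx.
apply: differentiable_invmx; first exact: differentiable_graph_metric.
exact: graph_metric_unit.
Qed.

Lemma curvature_mx_primal u v x : W x ->
  curvature_mx u v (primal u) (primal v) x =
  (cross_mx C (graph_pt x) (horizontal v) (vertical (u *m jac x)) -
   cross_mx C (graph_pt x) (horizontal u) (vertical (v *m jac x)))
  *m invmx (C (graph_pt x)).
Proof.
move=> Wx; have Ux := U_graph_pt Wx.
rewrite -log_derivative_curvature; first last.
- exact: (dmx_mixed_swap oU sk _ _ Ux).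
- exact: (differentiable_dmx_mixed oU sk _ Ux).
- exact: (differentiable_dmx_mixed oU sk _ Ux).
- exact: (differentiable_mixed sk Ux).
- exact: uk.
(* By the chain rule a derivative along a on the graph is the ambient one along (a, aJ), so the
   curvature of the restricted matrices is an instance of [log_derivative_curvature]. *)
have E a b : dmx a (primal b) x =
    dmx (horizontal a + vertical (a *m jac x)) (log_derivative C (horizontal b)) (graph_pt x).
  rewrite (dmx_comp a (differentiable_graph_pt Wx) (differentiable_log_graph b Wx)).
  by rewrite dmx_graph_pt // horizontalD_vertical.
by rewrite /curvature_mx (E u v) (E v u).
Qed.

Lemma curvature_primal_form u v w t x : W x ->
  (w *m curvature_mx u v (primal u) (primal v) x *m graph_metric x *m t^T) 0 0 =
  cross_form k (graph_pt x) u (v *m jac x) w (t *m jac x) -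
  cross_form k (graph_pt x) v (u *m jac x) w (t *m jac x).
Proof.
move=> Wx; have uC := uk (U_graph_pt Wx).
rewrite curvature_mx_primal // /graph_metric mulmxN mulNmx mulmxA.
rewrite !mulmxA mulmxKV // -(mulmxA _ _ t^T) -trmx_mul.
have E (S T : 'M[R]_n) (r : 'cV[R]_n) :
    (- (w *m (S - T) *m r)) 0 0 = (w *m T *m r) 0 0 - (w *m S *m r) 0 0.
  by rewrite mulmxBr mulmxBl opprB [LHS]mxE [X in _ + X]mxE.
by rewrite -E.
Qed.

Lemma sec_primal_form u v x : W x ->
  sec (div_metric D) (div_primal D) x u v =
  (v *m curvature_mx u v (primal u) (primal v) x *m graph_metric x *m u^T) 0 0.
Proof.
move=> Wx; rewrite (@sec_curvature_mx _ _ _ _ u v (primal u) (primal v)).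
- by rewrite div_metricE.
- by apply: (near_open oW Wx) => y; exact: connection_mx_primal.
- by apply: (near_open oW Wx) => y; exact: connection_mx_primal.
- exact: differentiable_primal.
- exact: differentiable_primal.
Qed.

(** Passing to the adjoint with respect to g exchanges u and v and changes the sign, so the dual
    case again reduces to the primal curvature matrix. *)
Lemma sec_dual_form u v x : W x ->
  sec (div_metric D) (div_dual D) x u v =
  - (u *m curvature_mx u v (primal u) (primal v) x *m graph_metric x *m v^T) 0 0.
Proof.
move=> Wx.
rewrite (@sec_curvature_mx _ _ _ _ u v (dual_connection_mx u) (dual_connection_mx v)).
- have dualE a : \near x, dmx a graph_metric x =
      primal a x *m graph_metric x + graph_metric x *m (dual_connection_mx a x)^T.
    apply: (near_open oW Wx) => y Wy; rewrite dmx_graph_metric //.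
    rewrite mul_log_derivative_metric // trmx_mul trmxK trmx_inv graph_metric_sym //.
    by rewrite mulKVmx // graph_metric_unit.
  have dg : \near x, differentiable_mx graph_metric x.
    by apply: (near_open oW Wx); exact: differentiable_graph_metric.
  have H := curvature_mx_dual dg (dualE u) (dualE v)
    (differentiable_primal u Wx) (differentiable_primal v Wx)
    (differentiable_dual u Wx) (differentiable_dual v Wx).
  have gs := graph_metric_sym Wx.
  rewrite -(mulmxA u) H div_metricE //; move: gs {H}.
  move: (graph_metric x) (curvature_mx _ _ _ _ x) => g B gs.
  rewrite mulmxN mulNmx [in RHS]mxE opprK.
  rewrite -[LHS](_ : (v *m B *m g *m u^T)^T 0 0 = _); last by rewrite mxE.
  by rewrite !trmx_mul trmxK gs !mulmxA.
- by apply: (near_open oW Wx) => y; exact: connection_mx_dual.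
- by apply: (near_open oW Wx) => y; exact: connection_mx_dual.
- exact: differentiable_dual.
- exact: differentiable_dual.
Qed.

Lemma graph_inner u v x : W x -> inner (div_metric D) x u v =
  - mixed_form k (graph_pt x) u (v *m jac x).
Proof.
move=> Wx; rewrite /inner div_metricE // /graph_metric /mixed_form mulmxN mulNmx mxE.
by rewrite trmx_mul !mulmxA.
Qed.

Variable kappa : R.
Hypothesis cross_kappa : forall z v v', U z ->
  cross_form k z v v' v v' = 2 * kappa * mixed_form k z v v' ^+ 2.

(** On the graph every mixed form is - g. In the primal case one value of S polarizes to kappa (g(u,
    v)^2 + g(u, u) g(v, v)) and the other to 2 kappa g(v, u)^2; their difference is kappa times the
    Gram determinant. *)
Lemma sec_graph u v x : W x ->
  sec (div_metric D) (div_primal D) x u v = kappa * gram (div_metric D) x u v /\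
  sec (div_metric D) (div_dual D) x u v = kappa * gram (div_metric D) x u v.
Proof.
move=> Wx; have Ux := U_graph_pt Wx.
have P := cross_form_polarized oU sk Ux (fun v v' => cross_kappa v v' Ux).
have -> : gram (div_metric D) x u v =
    mixed_form k (graph_pt x) u (u *m jac x) * mixed_form k (graph_pt x) v (v *m jac x)
    - mixed_form k (graph_pt x) u (v *m jac x) ^+ 2.
  by rewrite /gram !graph_inner // sqrrN mulrNN.
split.
  rewrite (sec_primal_form u v Wx) (curvature_primal_form u v v u Wx) !P.
  rewrite (mixed_form_jacC v u Wx).
  by move: (mixed_form _ _ u _) (mixed_form _ _ v _) (mixed_form _ _ u _) => a b c; ring.
rewrite (sec_dual_form u v Wx) (curvature_primal_form u v u v Wx) !P.
rewrite (mixed_form_jacC v u Wx).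
by move: (mixed_form _ _ u _) (mixed_form _ _ v _) (mixed_form _ _ u _) => a b c; ring.
Qed.

(** On vectors (u, uJ) the four terms of [sec_split] take two values, each twice, which absorbs the
    factor 1/2. *)
Lemma sec_ambient_graph u v x : W x ->
  sec (split_metric k) (levi_civita (split_metric k)) (graph_pt x)
    (row_mx u (u *m jac x)) (row_mx v (v *m jac x)) =
  kappa * gram (split_metric k) (graph_pt x)
    (row_mx u (u *m jac x)) (row_mx v (v *m jac x)).
Proof.
move=> Wx; have Ux := U_graph_pt Wx.
have P := cross_form_polarized oU sk Ux (fun v v' => cross_kappa v v' Ux).
rewrite (sec_split oU sk uk) // !P /gram !split_metric_form.
rewrite (mixed_form_jacC v u Wx).
move: (mixed_form _ _ u _) (mixed_form _ _ v _) (mixed_form _ _ u _) => a b c.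
by field.
Qed.

End Graph.

(** For (v, 0) and (0, v') a single term of [sec_split] survives, with factor -1/2, while the Gram
    determinant is minus a quarter of the squared mixed form; hence 4 kappa becomes 2 kappa. *)
Lemma cross_form_sec (R : realType) n (k : 'rV[R]_(n + n) -> R)
    (U : set 'rV[R]_(n + n)) (oU : open U) (sk : smooth_on U k)
    (uk : forall z, U z -> mixed_mx k z \in unitmx) (kappa : R) z v v' :
  U z ->
  sec (split_metric k) (levi_civita (split_metric k)) z (row_mx v 0) (row_mx 0 v') =
  4 * kappa * gram (split_metric k) z (row_mx v 0) (row_mx 0 v') ->
  cross_form k z v v' v v' = 2 * kappa * mixed_form k z v v' ^+ 2.
Proof.
move=> Uz; rewrite (sec_split oU sk uk) // /gram !split_metric_form.
have w0 a a' b' : cross_form k z a a' 0 b' = 0.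
  by rewrite /cross_form !mul0mx mxE.
have v0 a' b b' : cross_form k z 0 a' b b' = 0.
  by rewrite (cross_formCl oU sk) // w0.
have m0 a' : mixed_form k z 0 a' = 0 by rewrite /mixed_form !mul0mx mxE.
have m0' a : mixed_form k z a 0 = 0 by rewrite /mixed_form trmx0 mulmx0 mxE.
rewrite !(w0, v0, m0, m0').
move: (cross_form _ _ _ _ _ _) (mixed_form _ _ _ _) => X y H.
have {}H : - 2^-1 * X = - 2^-1 * (2 * kappa * y ^+ 2).
  by apply: etrans (etrans H _); [ring|field].
apply: (mulfI _ H); by rewrite oppr_eq0 invr_eq0 pnatr_eq0.
Qed.

(** * Graphs of optimal transport *)

Section HMetric.
Context {R : realType} {n : nat} {M M' : smoothManifold R n}.
Variables (c : M * M' -> R) (a : chart R n M) (b : chart R n M').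

Lemma h_quadE z v : h_quad c a b z v =
  - (lsubmx v *m mixed_mx (cost_rep c a b) z *m (rsubmx v)^T) 0 0.
Proof.
rewrite /h_quad; congr (- _); rewrite [RHS]mxE exchange_big.
apply: eq_bigr => j _; rewrite [in RHS]mxE [X in _ * X]mxE mulr_suml.
by apply: eq_bigr => i _; rewrite [_ * lsubmx v 0 i]mulrC.
Qed.

Lemma h_metricE : h_metric c a b = split_metric (cost_rep c a b).
Proof.
apply/funext => z; apply/matrixP => i j; rewrite mxE !h_quadE.
rewrite -[RHS](delta_mx_form (split_metric (cost_rep c a b) z)).
rewrite -/(basis_vec i) -/(basis_vec j).
rewrite -[X in _ = (X *m _ *m _) 0 0]hsubmxK -[X in _ = (_ *m _ *m X^T) 0 0]hsubmxK.
rewrite off_diag_form.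
move: (basis_vec i) (basis_vec j) (mixed_mx _ z) => u v A.
rewrite [lsubmx (u + v)]linearD [rsubmx (u + v)]linearD /=.
rewrite [(_ + _)^T]linearD /= !mulmxDl !mulmxDr.
have E (S T : 'M[R]_1) : (S + T) 0 0 = S 0 0 + T 0 0 by rewrite mxE.
by rewrite !E; do 4! move: ((_ *m _) 0 0) => ?; ring.
Qed.

End HMetric.

(** * From charts to the local model *)

Section Charts.
Context {R : realType} {n : nat} {T : topologicalType}.
Implicit Types (a : chart R n T).

Lemma cinv_cimg a y : cimg a y -> cdom a (cinv a y) /\ ccoord a (cinv a y) = y.
Proof. by move=> [p ap <-]; rewrite (ccoordK (mem_set ap)). Qed.

Lemma cimg_ccoord a p : cdom a p -> cimg a (ccoord a p).
Proof. by move=> ap; exists p. Qed.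

Lemma cinvK a p : cdom a p -> cinv a (ccoord a p) = p.
Proof. by move=> ap; rewrite (ccoordK (mem_set ap)). Qed.

End Charts.

Section LocalRepresentation.
Context {R : realType} {n : nat} {M M' : smoothManifold R n}.
Variables (c : M * M' -> R) (phi : M -> R) (f : M -> M').
Hypotheses (c_smooth : smooth_cost c) (c_nondeg : nondegenerate_cost c).
Hypothesis hf : optimal_transport c phi f.
Variables (a : chart R n M) (b : chart R n M').
Hypotheses (aM : atlas a) (bM : atlas b).

Local Notation k := (cost_rep c a b).

Definition chart_dom : set 'rV[R]_(n + n) :=
  [set z | cimg a (lsubmx z) /\ cimg b (rsubmx z)].

Definition map_rep y := ccoord b (f (cinv a y)).

(** The image under f of a chart domain need not lie in one chart of M', so the local map is
    restricted to the points sent into b. *)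
Definition map_dom : set 'rV[R]_n := [set y | cimg a y /\ cdom b (f (cinv a y))].

Lemma open_chart_dom : open chart_dom.
Proof.
rewrite openE => z [za zb]; apply: filterI.
  exact: (@continuous_lsubmx R 1 n n z _ (open_nbhs_nbhs (conj (@cimg_open _ _ _ a) za))).
exact: (@continuous_rsubmx R 1 n n z _ (open_nbhs_nbhs (conj (@cimg_open _ _ _ b) zb))).
Qed.

Lemma map_domE :
  ccoord a @` ([set: M] `&` cdom a `&` f @^-1` cdom b) = map_dom.
Proof.
apply/seteqP; split => [y [p [[_ ap] bp] <-]|y [ya yb]].
  by split; [exact: cimg_ccoord|rewrite cinvK].
have [ya' ay] := cinv_cimg ya.
by exists (cinv a y).
Qed.

Lemma f_continuous p : {for p, continuous f}.
Proof. by have [_ _ _ [[cf _] _ _]] := hf; exact: cf. Qed.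

Lemma open_map_dom : open map_dom.
Proof.
rewrite openE => y [ya yb]; apply: filterI.
  by apply: open_nbhs_nbhs; split => //; exact: cimg_open.
have ca := cinv_continuous ya; have cf := @f_continuous (cinv a y).
exact: (ca _ (cf _ (open_nbhs_nbhs (conj (@cdom_open _ _ _ b) yb)))).
Qed.

Lemma smooth_cost_rep : smooth_on chart_dom k.
Proof. exact: c_smooth. Qed.

Lemma smooth_map_rep j : smooth_on map_dom (fun y => map_rep y 0 j).
Proof. by have [_ _ _ [[_ sf] _ _]] := hf; rewrite -map_domE; exact: sf. Qed.

Lemma smooth_phi_rep : smooth_on map_dom (phi \o cinv a).
Proof. by have [sphi _ _ _] := hf; move=> s y [ya _]; exact: sphi aM s y ya. Qed.

Lemma chart_dom_map y y' : map_dom y -> map_dom y' -> chart_dom (row_mx y (map_rep y')).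
Proof.
move=> [ya _] [_ yb]; rewrite /chart_dom /= row_mxKl row_mxKr; split => //.
exact: cimg_ccoord.
Qed.

Lemma mixed_mx_unit z : chart_dom z -> mixed_mx k z \in unitmx.
Proof.
move=> [[p ap pE] [q bq qE]]; have := c_nondeg aM bM ap bq.
by rewrite pE qE hsubmxK.
Qed.

Lemma c_transform_graph p :
  c_transform c phi (f p) = (c (p, f p) - phi p)%:E.
Proof.
have [_ _ /(_ p)[+ _] _] := hf.
(* Its sum with phi p is a real number, so the c-transform at f p cannot be infinite. *)
case: (c_transform _ _ _) => [r| |] //= [] <-; congr (_%:E).
by rewrite addrAC subrr add0r.
Qed.

Lemma c_transform_le p q : (c_transform c phi q <= (c (p, q) - phi p)%:E)%E.
Proof. by apply: ereal_inf_lbound; exists p. Qed.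

Lemma div_repE y y' : map_dom y -> map_dom y' ->
  div_rep c phi f a y y' = k (row_mx y (map_rep y')) - (phi \o cinv a) y
    - (k (graph_pt map_rep y') - (phi \o cinv a) y').
Proof.
move=> [ya yb] [ya' yb'].
rewrite /div_rep /c_divergence /= c_transform_graph /=.
by rewrite /cost_rep /graph_pt !row_mxKl !row_mxKr /map_rep cinvK.
Qed.

Lemma div_rep_ge0 y y' : 0 <= div_rep c phi f a y y'.
Proof.
rewrite /div_rep /c_divergence /= subr_ge0.
have := c_transform_le (cinv a y) (f (cinv a y')).
by rewrite c_transform_graph lee_fin.
Qed.

(** The coordinate expression G of the inverse is differentiable, and the chain rule for G after
    [map_rep], the identity near y, exhibits an inverse matrix. *)
Lemma jac_map_rep_unit y : map_dom y -> jac map_rep y \in unitmx.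
Proof.
move=> Wy; have [_ _ _ [_ _ [finv fK [_ sfinv]]]] := hf.
pose G z := ccoord a (finv (cinv b z)).
have [ya yb] := Wy; have [ay aK] := cinv_cimg ya.
have dG : differentiable_mx G (map_rep y).
  move=> i j; rewrite ord1; apply: (sfinv b a bM aM j [::]).
  exists (f (cinv a y)) => //; split; last by rewrite /= fK.
  by split => //; exists (cinv a y).
have dF := differentiable_F smooth_map_rep Wy.
have E v : dmx v (fun y => G (map_rep y)) y = v.
  rewrite -[RHS](dmx_id y v); apply: near_eq_dmx.
  apply: (near_open open_map_dom Wy) => x [xa xb].
  by rewrite /G /map_rep cinvK // fK; have [] := cinv_cimg xa.
have jE (v : 'rV[R]_n) : v *m (jac map_rep y *m jac G (map_rep y)) = v.
  rewrite -{2}(E v) (dmx_comp v dF dG) (dmx_F smooth_map_rep v Wy) mulmxA.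
  apply/rowP => j; rewrite dmxE (derive_pd _ (dG 0 j)) mxE.
  by apply: eq_bigr => i _; rewrite [jac G _ _ _]mxE.
suff /mulmx1_unit[] : jac map_rep y *m jac G (map_rep y) = 1%:M by [].
by apply/row_matrixP => i; rewrite rowE jE row1.
Qed.

Variable alpha : R.
Hypothesis c_cross : constant_cross_curvature c (- 4 * alpha).

Lemma cross_form_alpha z v v' : chart_dom z ->
  cross_form k z v v' v v' = 2 * (- alpha) * mixed_form k z v v' ^+ 2.
Proof.
move=> Uz; apply: (cross_form_sec open_chart_dom smooth_cost_rep mixed_mx_unit Uz).
have [[p ap pE] [q bq qE]] := Uz.
have := c_cross aM bM ap bq v v'.
by rewrite /= pE qE hsubmxK /sec_bar h_metricE mulNr mulrN.
Qed.

Lemma sec_graph_chart x u v : map_dom x ->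
  let D := div_rep c phi f a in
  sec (div_metric D) (div_primal D) x u v = - alpha * gram (div_metric D) x u v /\
  sec (div_metric D) (div_dual D) x u v = - alpha * gram (div_metric D) x u v.
Proof.
move=> Wx; apply: (sec_graph open_chart_dom smooth_cost_rep open_map_dom
  smooth_map_rep chart_dom_map smooth_phi_rep div_repE _ mixed_mx_unit
  jac_map_rep_unit cross_form_alpha _ _ Wx).
by move=> *; exact: div_rep_ge0.
Qed.

Lemma graph_tangentE x X : map_dom x -> graph_tangent f a b x X ->
  exists v, X = row_mx v (v *m jac map_rep x).
Proof.
move=> Wx [v ->]; exists v.
have dg := differentiable_graph_pt smooth_map_rep Wx.
rewrite -(dmx_graph_pt smooth_map_rep v Wx) -(derive_dmx v dg).
(* [graph_rep] reads its first component back through the chart, which returns y on the image of the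
   chart, a neighbourhood of x. *)
apply: near_eq_derive; apply: (near_open open_map_dom Wx) => y [ya _].
by rewrite /graph_rep /graph_pt /=; have [_ ->] := cinv_cimg ya.
Qed.

Lemma sec_bar_graph_chart x X Y : map_dom x ->
  graph_tangent f a b x X -> graph_tangent f a b x Y ->
  sec_bar c a b (graph_pt map_rep x) X Y =
  - alpha * gram (h_metric c a b) (graph_pt map_rep x) X Y.
Proof.
move=> Wx /(graph_tangentE Wx)[u ->] /(graph_tangentE Wx)[v ->].
rewrite /sec_bar h_metricE.
apply: (sec_ambient_graph open_chart_dom smooth_cost_rep open_map_dom
  smooth_map_rep chart_dom_map smooth_phi_rep div_repE _ mixed_mx_unit
  cross_form_alpha _ _ Wx).
by move=> *; exact: div_rep_ge0.
Qed.

End LocalRepresentation.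

Theorem theorem6 (R : realType) (n : nat) (hn : (2 <= n)%N)
    (M M' : smoothManifold R n) (c : M * M' -> R)
    (c_smooth : smooth_cost c) (c_nondeg : nondegenerate_cost c)
    (alpha : R) (c_cross : constant_cross_curvature c (- 4 * alpha))
    (phi : M -> R) (f : M -> M') (hf : optimal_transport c phi f) :
  (forall a : chart R n M, atlas a -> forall p : M, cdom a p ->
   forall X Y : 'rV[R]_n,
     let D := div_rep c phi f a in
     let g := div_metric D in
     let x := ccoord a p in
     sec g (div_primal D) x X Y = - alpha * gram g x X Y /\
     sec g (div_dual D) x X Y = - alpha * gram g x X Y)
  /\
  (forall (a : chart R n M) (b : chart R n M'), atlas a -> atlas b ->
   forall p : M, cdom a p -> cdom b (f p) ->
   forall X Y : 'rV[R]_(n + n),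
     graph_tangent f a b (ccoord a p) X ->
     graph_tangent f a b (ccoord a p) Y ->
     let z := row_mx (ccoord a p) (ccoord b (f p)) in
     sec_bar c a b z X Y = - alpha * gram (h_metric c a b) z X Y).
Proof.
have cover q : exists2 b : chart R n M', atlas b & cdom b q := atlas_cover q.
split=> [a aM p ap X Y D g x|a b aM bM p ap bp X Y tX tY z].
  (* The intrinsic statement mentions no chart of M'; any chart around f p provides the local
     model. *)
  have [b bM bp] := cover (f p).
  by apply: (sec_graph_chart c_smooth c_nondeg hf aM bM c_cross); split;
    [exact: cimg_ccoord|rewrite cinvK].
have Wx : map_dom f a b (ccoord a p) by split; [exact: cimg_ccoord|rewrite cinvK].
have -> : z = graph_pt (map_rep f a b) (ccoord a p).
  by rewrite /z /graph_pt /map_rep cinvK.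
exact: (sec_bar_graph_chart c_smooth c_nondeg hf aM bM c_cross Wx tX tY).
Qed.
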